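(* Let $k$ be an algebraically closed field of characteristic $2$, $V_4$ the Klein four group, and $\mathcal{C}$ the category of finite dimensional $kV_4$-modules. With the notation for indecomposable modules given in the context: (1) $\mathcal{P}roj=\mathcal{I}_D$ is contained in every ideal of $\mathcal{C}$ having a non-zero object. (2) For any $n\in\mathbb{Z}$, $\mathcal{I}_k=\mathcal{I}_{\Omega^n(k)}$ $(=\mathcal{C})$. (3) For any $n\in\mathbb{Z}_{>0}$ and $m=1,\dots,n-1$, $\mathcal{I}_{V_m(\infty)}\subsetneq\mathcal{I}_{V_n(\infty)}$. (4) For any $\alpha\in k$, $n\in\mathbb{Z}_{>0}$ and $m=1,\dots,n-1$, $\mathcal{I}_{V_m(\alpha)}\subsetneq\mathcal{I}_{V_n(\alpha)}$, except when $\alpha\notin\{0,1\}$ and $(m,n)=(1,2)$. (5) For $\alpha\in k$ with $\alpha\neq 0,1$, $\mathcal{I}_{V_2(\alpha)}=\mathcal{I}_{V_1(\alpha)}$. Moreover, for all $\gamma\in k\cup\{\infty\}$ and $n\in\mathbb{Z}_{>0}$ one has $\mathcal{P}roj\subsetneq\mathcal{I}_{V_n(\gamma)}\subsetneq\mathcal{I}_k=\mathcal{C}$, and there are no other nontrivial containments among the ideals $\mathcal{I}_M$, $M$ indecomposable, than those listed above (and those following from them by transitivity).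
   Context: $\mathcal{C}$ has the usual tensor product, dual and flip. An ideal of $\mathcal{C}$ is a full subcategory closed under retracts (direct summands) and under tensoring with arbitrary objects of $\mathcal{C}$. For $M\in\mathcal{C}$, $\mathcal{I}_M$ is the full subcategory of all modules isomorphic to a direct summand of $M\otimes W$ for some $W\in\mathcal{C}$. $\mathcal{P}roj$ is the full subcategory of projective modules. Let $g,h$ generate $V_4$ and $x=1+g$, $y=1+h$, so $kV_4=k[x,y]/(x^2,y^2)$. The indecomposable modules are (up to isomorphism): the projective module $D$ of dimension $4$; the Heller shifts $\Omega^n(k)$ of the trivial module, $n\in\mathbb{Z}$, of dimension $2|n|+1$ ($\Omega^0(k)=k$); for $n\in\mathbb{Z}_{>0}$ and $\alpha\in k$ the $2n$-dimensional module $V_n(\alpha)$ on $k^n\oplus k^n$ on which $x$ acts by $\begin{pmatrix}0&I_n\\0&0\end{pmatrix}$ and $y$ by $\begin{pmatrix}0&J_n(\alpha)\\0&0\end{pmatrix}$, $J_n(\alpha)$ being the Jordan block with eigenvalue $\alpha$; and the $2n$-dimensional module $V_n(\infty)$ on which $x$ acts by $\begin{pmatrix}0&J_n(0)\\0&0\end{pmatrix}$ and $y$ by $\begin{pmatrix}0&I_n\\0&0\end{pmatrix}$. *)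

(* Defs.v *)
From Stdlib Require Import Relation_Operators.
From mathcomp Require Import all_boot all_fingroup all_algebra all_character.
From mathcomp Require Import boolp classical_sets.

Set Implicit Arguments.
Unset Strict Implicit.
Unset Printing Implicit Defensive.

Import GRing.Theory.
Local Open Scope ring_scope.

(* The Klein four group is Z/2 x Z/2, with generators g = (1, 0) and
   h = (0, 1).  A finite dimensional kV_4-module is a matrix representation
   of arbitrary degree (degree 0 being the zero module).  Following MathComp,
   matrices act on row vectors from the right: a module described by matrices
   acting on columns is entered through their transposes, which is harmless
   since V_4 is abelian. *)
Definition V4 : {group 'Z_2 * 'Z_2} := [set: 'Z_2 * 'Z_2]%G.

Notation kV4mod k := (representation k V4).

Section Modules.
Variable k : fieldType.
Implicit Types M N L P W : kV4mod k.

Definition iso M N : Prop := mx_rsim M N.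

Definition tensor M N : kV4mod k := Representation (prod_repr M N).

Definition nonzero M : Prop := (0 < rdegree M)%N.

Definition summand M N : Prop := exists L, iso N (dadd_grepr M L).

Definition indecomposable M : Prop :=
  nonzero M /\
  forall N L, iso M (dadd_grepr N L) -> ~ nonzero N \/ ~ nonzero L.

Definition is_hom M N (f : 'M[k]_(rdegree M, rdegree N)) : Prop :=
  forall z, z \in V4 -> M z *m f = f *m N z.

Definition projective P : Prop :=
  forall N L (p : 'M_(rdegree N, rdegree L)) (f : 'M_(rdegree P, rdegree L)),
    is_hom p -> row_full p -> is_hom f ->
    exists2 f' : 'M_(rdegree P, rdegree N), is_hom f' & f' *m p = f.

Definition injective_module P : Prop :=
  forall L N (i : 'M_(rdegree L, rdegree N)) (f : 'M_(rdegree L, rdegree P)),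
    is_hom i -> row_free i -> is_hom f ->
    exists2 f' : 'M_(rdegree N, rdegree P), is_hom f' & i *m f' = f.

(* An epimorphism p is essential if f is onto whenever p \o f is; composition
   reads from left to right in terms of matrices. *)
Definition projective_cover P M (p : 'M[k]_(rdegree P, rdegree M)) : Prop :=
  [/\ projective P, is_hom p, row_full p &
      forall L (f : 'M_(rdegree L, rdegree P)),
        is_hom f -> row_full (f *m p) -> row_full f].

Definition injective_hull M P (i : 'M[k]_(rdegree M, rdegree P)) : Prop :=
  [/\ injective_module P, is_hom i, row_free i &
      forall L (f : 'M_(rdegree P, rdegree L)),
        is_hom f -> row_free (i *m f) -> row_free f].

Definition short_exact L M N (i : 'M[k]_(rdegree L, rdegree M))
    (p : 'M[k]_(rdegree M, rdegree N)) : Prop :=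
  [/\ is_hom i, is_hom p, row_free i, row_full p & (i == kermx p)%MS].

(* N is isomorphic to Omega(M), resp. to Omega^{-1}(M). *)
Definition syzygy M N : Prop :=
  exists P (i : 'M_(rdegree N, rdegree P)) (p : 'M_(rdegree P, rdegree M)),
    projective_cover p /\ short_exact i p.

Definition cosyzygy M N : Prop :=
  exists P (i : 'M_(rdegree M, rdegree P)) (p : 'M_(rdegree P, rdegree N)),
    injective_hull i /\ short_exact i p.

Fixpoint iter_rel (R : kV4mod k -> kV4mod k -> Prop) (n : nat) M N : Prop :=
  if n is n'.+1 then exists2 L, R M L & iter_rel R n' L N else iso M N.

(* N is isomorphic to Omega^n(M); note that Negz n is -(n + 1). *)
Definition heller (n : int) M N : Prop :=
  match n with
  | Posz n => iter_rel syzygy n M N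
  | Negz n => iter_rel cosyzygy n.+1 M N
  end.

Lemma trivial_mx_repr : mx_repr V4 (fun _ => 1%:M : 'M[k]_1).
Proof. by split=> // x y _ _; rewrite mulmx1. Qed.

Definition trivial_mod : kV4mod k :=
  Representation (MxRepresentation trivial_mx_repr).

(* The regular module kV_4, which is the indecomposable projective module of
   dimension 4. *)
Definition Dmod : kV4mod k := Representation (regular_repr k V4).

(* Full subcategories are given by their sets of objects.  Closure under
   summands includes closure under isomorphism, so that, by the flip, closure
   under tensoring on the left is automatic. *)
Definition tensor_ideal (I : set (kV4mod k)) : Prop :=
  (forall M N, I N -> summand M N -> I M) /\
  (forall M W, I M -> I (tensor M W)).

Definition Proj : set (kV4mod k) := [set M | projective M]%classic.

Definition ideal_of M : set (kV4mod k) :=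
  [set N | exists W, summand N (tensor M W)]%classic.

Section KleinRepr.
Variables (n : nat) (A B : 'M[k]_n).
Hypotheses (AA : A *m A = 1%:M) (BB : B *m B = 1%:M) (AB : A *m B = B *m A).

Definition klein_fun (z : 'Z_2 * 'Z_2) : 'M[k]_n := A ^+ z.1 *m B ^+ z.2.

Lemma klein_mx_repr : mx_repr V4 klein_fun.
Proof.
split=> [|[a b] [c d] _ _]; first by rewrite /klein_fun /= mulmx1.
have Z2 (u : 'Z_2) : u = 0 \/ u = 1.
  by case: u => [[|[|?]] ?] //; [left|right]; apply: val_inj.
have E (C : 'M[k]_n) (u v : 'Z_2) : C *m C = 1%:M ->
    C ^+ (Zp_add u v) = C ^+ u *m C ^+ v.
  by move=> CC; case: (Z2 u) => ->; case: (Z2 v) => ->;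
    rewrite /= ?expr0 ?expr1 ?mulmx1 ?mul1mx ?CC.
have cBA : B ^+ b *m A ^+ c = A ^+ c *m B ^+ b.
  by apply: commrX; apply: commr_sym; apply: commrX; apply: AB.
rewrite /klein_fun -[LHS]/(A ^+ Zp_add a c *m B ^+ Zp_add b d) /= !E //.
by rewrite -!mulmxA (mulmxA (A ^+ c)) -cBA !mulmxA.
Qed.

Definition klein_mod : kV4mod k := Representation (MxRepresentation klein_mx_repr).
End KleinRepr.

Definition Jordan n (a : k) : 'M[k]_n :=
  \matrix_(i, j) (if i == j then a else (j == i.+1 :> nat)%:R).

Section VModules.
Hypothesis char2 : 2%N \in [pchar k].
Variables (n : nat) (c : option k).

(* The index c ranges over k + {oo}, None being the point at infinity.  The
   matrices Vx and Vy of x = 1 + g and y = 1 + h act on columns. *)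
Definition Vx : 'M[k]_(n + n) :=
  block_mx 0 (if c is Some _ then 1%:M else Jordan n 0) 0 0.
Definition Vy : 'M[k]_(n + n) :=
  block_mx 0 (if c is Some a then Jordan n a else 1%:M) 0 0.

Definition Vg : 'M[k]_(n + n) := (1%:M + Vx)^T.
Definition Vh : 'M[k]_(n + n) := (1%:M + Vy)^T.

Let nilE (S T : 'M[k]_n) :
  (block_mx 0 S 0 0 : 'M_(n + n)) *m (block_mx 0 T 0 0 : 'M_(n + n)) = 0.
Proof. by rewrite mulmx_block !(mulmx0, mul0mx, addr0) block_mx0. Qed.

Let addxx (C : 'M[k]_(n + n)) : C + C = 0.
Proof. by apply/matrixP=> i j; rewrite !mxE -mulr2n (mulrn_pchar char2). Qed.

Let involE (S : 'M[k]_n) :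
  let C := (1%:M + (block_mx 0 S 0 0 : 'M_(n + n)))^T in C *m C = 1%:M.
Proof.
rewrite /= -trmx_mul mulmxDl !mulmxDr !mul1mx mulmx1 nilE addr0.
by rewrite -addrA addxx addr0 trmx1.
Qed.

Lemma VgVg : Vg *m Vg = 1%:M. Proof. exact: involE. Qed.

Lemma VhVh : Vh *m Vh = 1%:M. Proof. exact: involE. Qed.

Lemma VgVh : Vg *m Vh = Vh *m Vg.
Proof.
rewrite /Vg /Vh -!trmx_mul; congr (_^T).
rewrite !mulmxDl !mulmxDr !mul1mx !mulmx1 !nilE !addr0.
by rewrite -!addrA; congr (_ + _); rewrite addrC.
Qed.

Definition Vmod : kV4mod k := klein_mod VgVg VhVh VgVh.
End VModules.

(* The containments ideal_of M `<=` ideal_of N between indecomposable modules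
   asserted explicitly in the theorem, together with the trivial ones coming
   from isomorphisms.  The equality of the ideals of V_1(a) and V_2(a) for a
   outside {0, 1} is split into its two inclusions, of which one is an instance
   of listed_V. *)
Inductive listed (char2 : 2%N \in [pchar k]) : kV4mod k -> kV4mod k -> Prop :=
| listed_iso M N : iso M N -> listed char2 M N
| listed_D N : indecomposable N -> listed char2 Dmod N
| listed_k_Omega (n : int) M :
    heller n trivial_mod M -> listed char2 trivial_mod M
| listed_Omega_k (n : int) M :
    heller n trivial_mod M -> listed char2 M trivial_mod
| listed_V (c : option k) (m n : nat) :
    (0 < m < n)%N -> listed char2 (Vmod char2 m c) (Vmod char2 n c)
| listed_V2_V1 (a : k) :
    a != 0 -> a != 1 ->
    listed char2 (Vmod char2 2 (Some a)) (Vmod char2 1 (Some a))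
| listed_V_k (c : option k) (n : nat) :
    (0 < n)%N -> listed char2 (Vmod char2 n c) trivial_mod.

End Modules.

Arguments Proj k _ : clear implicits.

(* Main.v *)
(** Write x = 1 + g, y = 1 + h.  For a module M that is free over k<g>, choose
    a linear e with e + g e g = 1; then t = e + h e h is an endomorphism of M,
    unique up to maps d + h d h with d commuting with g, i.e. up to maps
    factoring through a projective.  Since e (x) 1 serves M (x) W, the modules
    on which (t - b)^n is stably zero form an ideal; conversely, for such an M
    the relation (t - b)^n = d + h d h is precisely what is needed to split M
    off V_n(b) (x) M.  On V_n(b) itself t acts as J + x (J + J^2) with
    J = J_n(b), so (t - b)^n = n (b^2 + b) x (J - b)^(n-1), which is stably zero
    unless n = 1 and b is not in F_2.  This yields all (non-)containments
    between the ideals of the V_n(b), the point oo being treated by exchanging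
    g and h.

    The Omega^n(k) have odd dimension, so that k is a summand of M (x) M^*.

    The classification of the indecomposables is proved through Omega: a
    non-projective indecomposable is a pair (X, Y) of matrices, Omega^(-1)
    turns an a x b pair into a b x (2b - a) pair, and this descends to k when
    a > b.  When a = b, Omega^(-1) shortens polynomial null vectors of the
    pencil X + lambda Y, so the pencil is regular and Fitting's lemma together
    with the Jordan form applies. *)
Require Import Defs.
From Stdlib Require Import Relation_Operators.
From mathcomp Require Import all_boot all_fingroup all_algebra all_character.
From mathcomp Require Import boolp classical_sets mxtens ring.

Import GRing.Theory.
Local Open Scope classical_set_scope.
Local Open Scope ring_scope.

Set Implicit Arguments.
Unset Strict Implicit.
Unset Printing Implicit Defensive.

(** On a module where x maps the top isomorphically onto the socle, t induces x^(-1) y; in general t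
    is a substitute for x^(-1) y that exists as soon as M is free over k<g>. The obstacle is the
    coproduct: x acts on M (x) W as x (x) 1 + 1 (x) x + x (x) x, so formulas in x and y do not pass
    to tensor products. Conjugation by group elements does, since z (e (x) 1) z = z e z (x) 1 when
    z^2 = 1. The price is the quadratic terms in e + g e g and e + h e h, which produce b^2 + b. The
    zeros of b^2 + b, together with oo, are the points where V_1(b) is a permutation module, on the
    cosets of <h>, <gh> or <g>; there V_1(b) (x) V_1(b) is two copies of V_1(b), while elsewhere it
    is V_2(b). Non-containments compare exponents. No exponent below m works for V_m(b), and n works
    for V_n(b), except that 2 is used if n = 1 and b is not in F_2. The only pair left undecided is
    V_2(b) against V_1(b) for such b, and there an explicit retraction gives the containment. *)

(** * Summands as retracts, and idempotents *)

Section Retracts.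
Variable k : fieldType.
Implicit Types M N L P W : kV4mod k.

(** Summands are handled through a pair of maps, so that no complement has to be produced;
    [summandP] recovers the complement. *)
Definition retract M N :=
  exists i, exists r, [/\ @is_hom k M N i, @is_hom k N M r & i *m r = 1%:M].

Lemma is_hom_mul M N L (f : 'M_(rdegree M, rdegree N)) (g : 'M_(rdegree N, rdegree L)) :
  is_hom f -> is_hom g -> is_hom (f *m g).
Proof. by move=> hf hg z z4; rewrite mulmxA hf // -!mulmxA hg. Qed.

Lemma is_hom1 M : @is_hom k M M 1%:M.
Proof. by move=> z _; rewrite mulmx1 mul1mx. Qed.

Lemma retract_trans M N L : retract M N -> retract N L -> retract M L.
Proof.
move=> [i [r [hi hr ir]]] [j [s [hj hs js]]]; exists (i *m j), (s *m r).
split; [exact: is_hom_mul..|].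
by rewrite -mulmxA [j *m _]mulmxA js mul1mx.
Qed.

Lemma iso_sym M N : iso M N -> iso N M.
Proof. exact: mx_rsim_sym. Qed.

Lemma iso_trans M N L : iso M N -> iso N L -> iso M L.
Proof. exact: mx_rsim_trans. Qed.

Lemma isoP M N :
  iso M N <-> exists i, exists r,
    [/\ @is_hom k M N i, @is_hom k N M r, i *m r = 1%:M & r *m i = 1%:M].
Proof.
split.
  move=> [B def_n freeB homB]; have /row_freeP [C BC] := freeB.
  have CB : C *m B = 1%:M.
    move: B C freeB BC {homB}; rewrite -def_n => B C _ BC.
    exact: mulmx1C.
  exists B, C; split=> // z z4.
  by rewrite -[N z]mul1mx -CB -!mulmxA (mulmxA B) -homB // -!mulmxA BC mulmx1.
move=> [i [r [hi hr ir ri]]].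
have f1 : row_free i by apply/row_freeP; exists r.
have f2 : row_free r by apply/row_freeP; exists i.
exists i => //; apply/eqP; rewrite eqn_leq; apply/andP; split.
  by move/eqP: f1 => {1}<-; apply: rank_leq_col.
by move/eqP: f2 => {1}<-; apply: rank_leq_col.
Qed.

Lemma iso_retract M N : iso M N -> retract M N.
Proof. by case/isoP=> i [r [hi hr ir _]]; exists i, r. Qed.

Lemma retract_dadd M L : retract M (dadd_grepr M L).
Proof.
exists (row_mx 1%:M 0), (col_mx 1%:M 0); split=> [z _|z _|] /=.
- by rewrite mul_mx_row mul_row_block !mulmx1 !mul1mx !mulmx0 !mul0mx !addr0.
- by rewrite mul_block_col mul_col_mx !mulmx1 !mul1mx !mulmx0 !mul0mx !addr0.
by rewrite mul_row_col mulmx1 mul0mx addr0.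
Qed.

(** The row spaces of e and 1 - e are complementary submodules. The degrees are recorded because
    indecomposability is a statement about degrees being zero; i and r identify the first summand
    with the image of e. *)
Lemma idempotent_decomposition N (e : 'M_(rdegree N)) :
  is_hom e -> e *m e = e ->
  exists M L, [/\ iso N (dadd_grepr M L), rdegree M = \rank e,
    rdegree L = \rank (1%:M - e) &
    exists i : 'M_(rdegree M, rdegree N), exists r : 'M_(rdegree N, rdegree M),
      [/\ is_hom i, is_hom r, i *m r = 1%:M & r *m i = e]].
Proof.
move=> he ee.
have mode : mxmodule N e.
  by apply/mxmoduleP=> z z4; rewrite -he //; apply: submxMl.
pose f := 1%:M - e.
have modf : mxmodule N f.
  apply/mxmoduleP=> z z4.
  by rewrite mulmxBl mul1mx -he // -[X in X - _]mulmx1 -mulmxBr submxMl.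
have fe : f *m e = 0 by rewrite mulmxBl mul1mx ee subrr.
have ef : e *m f = 0 by rewrite mulmxBr mulmx1 ee subrr.
have dx : mxdirect (e + f).
  apply/mxdirect_addsP/eqP; rewrite -submx0.
  apply/row_subP=> i; set u := row i _.
  have : (u <= e :&: f)%MS by apply: row_sub.
  rewrite sub_capmx => /andP[/submxP[a ua] /submxP[b ub]].
  have : u *m f = u by rewrite ub -mulmxA mulmxBr mulmx1 fe subr0.
  by rewrite ua -mulmxA ef mulmx0 => <-; rewrite sub0mx.
have sum1 : (e + f :=: 1%:M)%MS.
  apply/eqmxP; rewrite submx1 /=.
  have -> : (1%:M : 'M[k]_(rdegree N)) = e + f by rewrite addrC subrK.
  exact: addmx_sub_adds.
exists (Representation (submod_repr mode)), (Representation (submod_repr modf)).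
split=> //.
  have mod1 : mxmodule N (1%:M : 'M_(rdegree N)) by apply: mxmodule1.
  apply: (iso_trans (N := Representation (submod_repr mod1))).
    by apply: iso_sym; apply: rsim_submod1.
  apply: (@mx_rsim_dadd _ _ _ _ N e f 1%:M (Representation (submod_repr mode))
    (Representation (submod_repr modf)) mode modf mod1) => //; exact: mx_rsim_refl.
exists (val_submod 1%:M), (in_submod e e); split=> /=.
- move=> z z4; rewrite -[RHS](val_submodJ mode) // mul1mx.
  by rewrite [RHS]val_submodE.
- move=> z z4; rewrite -[RHS](in_submodJ mode z (submx_refl e)) -he //.
  by rewrite [LHS]mulmxA.
- rewrite in_submodE mulmxA -in_submodE.
  rewrite -[RHS](val_submodK (U := e)); congr in_submod.
  have /submxP[a ->] : (val_submod (1%:M : 'M_(\rank e)) <= e)%MS by rewrite val_submodP.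
  by rewrite -mulmxA ee.
by rewrite -val_submodE in_submodK.
Qed.

(** For the converse, r i is an idempotent endomorphism of N whose image is isomorphic to M, and the
    image of 1 - r i is the complement. *)
Lemma summandP M N : summand M N <-> retract M N.
Proof.
split=> [[L isoN]|].
  apply: (retract_trans (retract_dadd M L)); apply: iso_retract.
  exact: iso_sym.
move=> [i [r [hi hr ir]]].
have ee : (r *m i) *m (r *m i) = r *m i.
  by rewrite -mulmxA (mulmxA i) ir mul1mx.
have [M' [L [isoN _ _ [j [s [hj hs js sj]]]]]] :=
  idempotent_decomposition (is_hom_mul hr hi) ee.
exists L; apply: (iso_trans isoN).
have isoM : iso M' M.
  apply/isoP; exists (j *m r), (i *m s); split; [exact: is_hom_mul..| |].
    by rewrite mulmxA -(mulmxA j) -sj !mulmxA js mul1mx js.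
  by rewrite mulmxA -(mulmxA i) sj !mulmxA ir mul1mx ir.
have /isoP [a [b [ha hb ab ba]]] := isoM.
apply/isoP; exists (block_mx a 0 0 1%:M), (block_mx b 0 0 1%:M).
split=> [z z4|z z4||] /=; rewrite !mulmx_block !mulmx0 !mul0mx !addr0 !add0r ?mulmx1 ?mul1mx.
- by rewrite ha.
- by rewrite hb.
- by rewrite ab -scalar_mx_block.
by rewrite ba -scalar_mx_block.
Qed.

Lemma indecomposable_idempotent M (e : 'M_(rdegree M)) :
  indecomposable M -> is_hom e -> e *m e = e -> e = 0 \/ e = 1%:M.
Proof.
move=> [_ indM] he ee.
have [N [L [isoM dN dL _]]] := idempotent_decomposition he ee.
case: (indM N L isoM); rewrite /nonzero ?dN ?dL => /negP; rewrite -leqNgt leqn0 mxrank_eq0 => /eqP.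
  by left.
by move=> e1; right; apply/esym/eqP; rewrite -subr_eq0 e1.
Qed.

Lemma indecomposable_retract M N : indecomposable N -> nonzero M -> retract M N -> iso N M.
Proof.
move=> indN nzM [i [r [hi hr ir]]].
have ee : (r *m i) *m (r *m i) = r *m i by rewrite -mulmxA (mulmxA i) ir mul1mx.
case: (indecomposable_idempotent indN (is_hom_mul hr hi) ee) => ri.
  have : (1%:M : 'M[k]_(rdegree M)) = 0.
    by rewrite -ir -[i]mul1mx -ir -!mulmxA (mulmxA r) ri mul0mx mulmx0.
  move: nzM; rewrite /nonzero; case: (rdegree M) => // n _ /matrixP /(_ 0 0) /eqP.
  by rewrite !mxE eqxx oner_eq0.
by apply/isoP; exists r, i.
Qed.

End Retracts.

(** * Maps into and out of tensor products *)

Section TensorFamilies.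
Variable k : fieldType.

(* A map U -> M (x) N, resp. M (x) N -> U, is given by one map U -> N, resp.
   N -> U, for each element of the standard basis of M. *)
Definition cofam m n l (Q : 'I_m -> 'M[k]_(l, n)) : 'M[k]_(l, m * n) :=
  \matrix_(a, jb) Q (mxtens_unindex jb).1 a (mxtens_unindex jb).2.

Definition fam m n l (P : 'I_m -> 'M[k]_(n, l)) : 'M[k]_(m * n, l) :=
  \matrix_(ia, b) P (mxtens_unindex ia).1 (mxtens_unindex ia).2 b.

Lemma sum_mxtens m n (F : 'I_(m * n) -> k) :
  \sum_ij F ij = \sum_i \sum_j F (mxtens_index (i, j)).
Proof.
rewrite pair_big /= (reindex (@mxtens_index m n)) /=.
  by apply: eq_bigr => -[].
by exists (@mxtens_unindex m n) => ij _; rewrite (mxtens_indexK, mxtens_unindexK).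
Qed.

Lemma cofam_fam m n l p (Q : 'I_m -> 'M[k]_(l, n)) (P : 'I_m -> 'M[k]_(n, p)) :
  cofam Q *m fam P = \sum_i Q i *m P i.
Proof.
apply/matrixP=> a b; rewrite summxE mxE sum_mxtens; apply: eq_bigr => i _.
by rewrite mxE; apply: eq_bigr => j _; rewrite !mxE mxtens_indexK.
Qed.

Lemma mul_cofam m n l p (C : 'M[k]_(p, l)) (Q : 'I_m -> 'M[k]_(l, n)) :
  C *m cofam Q = cofam (fun i => C *m Q i).
Proof.
by apply/matrixP=> a b; rewrite !mxE; apply: eq_bigr => j _; rewrite !mxE.
Qed.

Lemma fam_mul m n l p (C : 'M[k]_(l, p)) (P : 'I_m -> 'M[k]_(n, l)) :
  fam P *m C = fam (fun i => P i *m C).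
Proof.
by apply/matrixP=> a b; rewrite !mxE; apply: eq_bigr => j _; rewrite !mxE.
Qed.

(** [tprod] is built by recursion on rows and blocks, [*t] by an entrywise formula in the indices
    [mxtens_index]; the latter is what computations with [cofam] and [fam] need. *)
Lemma tprod_tens m1 n1 m2 n2 (A : 'M[k]_(m1, n1)) (B : 'M[k]_(m2, n2)) :
  tprod A B = A *t B.
Proof.
have split_tens u v (i : 'I_u.+1) (j : 'I_v) :
    mxtens_index (i, j) = (if unlift ord0 i is Some i' then
      rshift v (mxtens_index (i', j)) else lshift (u * v) j) :> 'I_(v + u * v).
  case: unliftP => [i' ->|->]; apply: val_inj => //=.
  by rewrite /bump /= add1n mulSn addnA.
have trow_tens n (a : 'rV[k]_n) (j : 'I_n) (b : 'I_n2) (c : 'I_m2) :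
    trow a B c (mxtens_index (j, b)) = a 0 j * B c b.
  elim: n a j => [|n IH] a j; first by case: j.
  rewrite split_tens /=; case: unliftP => [j' ->|->].
    rewrite row_mxEr IH mxE; congr (a _ _ * _); exact: val_inj.
  rewrite row_mxEl !mxE; congr (a _ _ * _); exact: val_inj.
apply/matrixP=> i j; case: (mxtens_indexP i) (mxtens_indexP j) => {i} i a [{j} j b].
rewrite tensmxE; elim: m1 A i => [|m1 IH] A i; first by case: i.
rewrite split_tens /=; case: unliftP => [i' ->|->].
  rewrite col_mxEd IH mxE; congr (A _ _ * _); exact: val_inj.
rewrite col_mxEu trow_tens mxE; congr (A _ _ * _); exact: val_inj.
Qed.

Lemma cofam_tprod m m' n n' l (Q : 'I_m -> 'M[k]_(l, n)) (A : 'M_(m, m')) (B : 'M_(n, n')) :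
  cofam Q *m tprod A B = cofam (fun j => \sum_i A i j *: (Q i *m B)).
Proof.
apply/matrixP=> a jb; case: (mxtens_indexP jb) => j b.
rewrite tprod_tens !mxE summxE sum_mxtens mxtens_indexK; apply: eq_bigr => i _.
rewrite !mxE mulr_sumr; apply: eq_bigr => c _.
by rewrite tensmxE mxE mxtens_indexK mulrCA.
Qed.

Lemma tprod_fam m m' n n' l (P : 'I_m' -> 'M[k]_(n', l)) (A : 'M_(m, m')) (B : 'M_(n, n')) :
  tprod A B *m fam P = fam (fun i => \sum_j A i j *: (B *m P j)).
Proof.
apply/matrixP=> ia b; case: (mxtens_indexP ia) => i a.
rewrite tprod_tens !mxE summxE sum_mxtens mxtens_indexK; apply: eq_bigr => j _.
rewrite !mxE mulr_sumr; apply: eq_bigr => c _.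
by rewrite tensmxE mxE mxtens_indexK mulrA.
Qed.

Lemma eq_cofam m n l (Q Q' : 'I_m -> 'M[k]_(l, n)) : Q =1 Q' -> cofam Q = cofam Q'.
Proof. by move=> eQ; apply/matrixP=> a b; rewrite !mxE eQ. Qed.

Lemma eq_fam m n l (P P' : 'I_m -> 'M[k]_(n, l)) : P =1 P' -> fam P = fam P'.
Proof. by move=> eP; apply/matrixP=> a b; rewrite !mxE eP. Qed.

Lemma cofam_inj m n l (Q Q' : 'I_m -> 'M[k]_(l, n)) : cofam Q = cofam Q' -> Q =1 Q'.
Proof.
move=> /matrixP eQ i; apply/matrixP=> a b.
by have := eQ a (mxtens_index (i, b)); rewrite !mxE mxtens_indexK.
Qed.

Lemma fam_inj m n l (P P' : 'I_m -> 'M[k]_(n, l)) : fam P = fam P' -> P =1 P'.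
Proof.
move=> /matrixP eP i; apply/matrixP=> a b.
by have := eP (mxtens_index (i, a)) b; rewrite !mxE mxtens_indexK.
Qed.

Lemma cofamE m n l (A : 'M[k]_(l, m * n)) :
  A = cofam (fun i => \matrix_(a, b) A a (mxtens_index (i, b))).
Proof. by apply/matrixP=> a jb; case: (mxtens_indexP jb) => j b; rewrite !mxE mxtens_indexK. Qed.

Lemma famE m n l (A : 'M[k]_(m * n, l)) :
  A = fam (fun i => \matrix_(a, b) A (mxtens_index (i, a)) b).
Proof. by apply/matrixP=> jb a; case: (mxtens_indexP jb) => j b; rewrite !mxE mxtens_indexK. Qed.

Lemma tprodZl m n p q (B : 'M[k]_(p, q)) c (A : 'M[k]_(m, n)) :
  tprod (c *: A) B = c *: tprod A B.
Proof. by rewrite !tprod_tens; apply/matrixP=> i j; rewrite !mxE mulrA. Qed.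

Lemma tprodDl m n p q (B : 'M[k]_(p, q)) (A A' : 'M[k]_(m, n)) :
  tprod (A + A') B = tprod A B + tprod A' B.
Proof. by rewrite !tprod_tens; apply/matrixP=> i j; rewrite !mxE mulrDl. Qed.

Lemma tprod_suml m n p q (B : 'M[k]_(p, q)) (I : finType) (F : I -> 'M[k]_(m, n)) :
  tprod (\sum_i F i) B = \sum_i tprod (F i) B.
Proof.
rewrite (big_morph (fun A => tprod A B) (tprodDl B) (id1 := 0)) //.
by rewrite -[0 in LHS](scale0r 0) tprodZl scale0r.
Qed.

Variables (M N L : kV4mod k).

Lemma cofam_hom (Q : 'I_(rdegree M) -> 'M[k]_(rdegree L, rdegree N)) :
  (forall z, z \in V4 -> forall j, \sum_i M z i j *: (Q i *m N z) = L z *m Q j) ->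
  @is_hom k L (tensor M N) (cofam Q).
Proof.
by move=> hQ z z4; rewrite cofam_tprod mul_cofam; apply: eq_cofam => j; rewrite hQ.
Qed.

Lemma fam_hom (P : 'I_(rdegree M) -> 'M[k]_(rdegree N, rdegree L)) :
  (forall z, z \in V4 -> forall i, \sum_j M z i j *: (N z *m P j) = P i *m L z) ->
  @is_hom k (tensor M N) L (fam P).
Proof.
by move=> hP z z4; rewrite tprod_fam fam_mul; apply: eq_fam => j; rewrite hP.
Qed.

Lemma hom_cofam (Q : 'I_(rdegree M) -> 'M[k]_(rdegree L, rdegree N)) :
  @is_hom k L (tensor M N) (cofam Q) ->
  forall z, z \in V4 -> forall j, \sum_i M z i j *: (Q i *m N z) = L z *m Q j.
Proof.
move=> hQ z z4; apply: cofam_inj.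
by have := hQ z z4; rewrite cofam_tprod mul_cofam => ->.
Qed.

Lemma hom_fam (P : 'I_(rdegree M) -> 'M[k]_(rdegree N, rdegree L)) :
  @is_hom k (tensor M N) L (fam P) ->
  forall z, z \in V4 -> forall i, \sum_j M z i j *: (N z *m P j) = P i *m L z.
Proof.
move=> hP z z4; apply: fam_inj.
by have := hP z z4; rewrite tprod_fam fam_mul => ->.
Qed.

End TensorFamilies.

(** * The ideal generated by one module *)

Section IdealOf.
Variable k : fieldType.
Implicit Types M N L P W : kV4mod k.

(** Tensoring each member of the two families with the identity of L gives the new families
    directly; this takes the place of an associativity isomorphism. *)
Lemma retract_tensorA M V W L :
  retract M (tensor V W) -> retract (tensor M L) (tensor V (tensor W L)).
Proof.
move=> [i [r []]]; rewrite (cofamE i) (famE r).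
set Q := fun _ => _; set P := fun _ => _ => hQ hP QP.
exists (cofam (fun j => tprod (Q j) 1%:M)), (fam (fun j => tprod (P j) 1%:M)); split.
- apply: (@cofam_hom k V (tensor W L)) => z z4 j /=.
  rewrite -tprodE mulmx1 -[L z in RHS]mul1mx -(hom_cofam hQ) // mul1mx tprod_suml.
  by apply: eq_bigr => i' _; rewrite tprodZl -tprodE mul1mx.
- apply: (@fam_hom k V (tensor W L)) => z z4 j /=.
  rewrite -tprodE mul1mx -[L z in RHS]mulmx1 -(hom_fam hP) // mulmx1 tprod_suml.
  by apply: eq_bigr => i' _; rewrite tprodZl -tprodE mulmx1.
rewrite cofam_fam -tprod1 -QP cofam_fam tprod_suml.
by apply: eq_bigr => i' _; rewrite -tprodE mulmx1.
Qed.

Lemma ideal_ofP M N : ideal_of M N <-> exists W, retract N (tensor M W).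
Proof. by split=> -[W /summandP]; exists W => //; apply/summandP. Qed.

Lemma ideal_of_retract M N L : ideal_of M N -> retract L N -> ideal_of M L.
Proof.
move=> /ideal_ofP[W NW] LN; apply/ideal_ofP; exists W; exact: retract_trans LN NW.
Qed.

Lemma ideal_of_tensor M N W : ideal_of M N -> ideal_of M (tensor N W).
Proof.
move=> /ideal_ofP[L NL]; apply/ideal_ofP; exists (tensor L W); exact: retract_tensorA.
Qed.

Lemma ideal_of_ideal M : tensor_ideal (ideal_of M).
Proof.
split=> [N L IL /summandP NL|N W]; [exact: ideal_of_retract NL|exact: ideal_of_tensor].
Qed.

Lemma retract_unitl W : retract W (tensor (trivial_mod k) W).
Proof.
exists (cofam (fun _ => 1%:M)), (fam (fun _ => 1%:M)); split.
- apply: (@cofam_hom k (trivial_mod k)) => z z4 j.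
  by rewrite zmodp.big_ord1 /= !(ord1, mxE, eqxx) scale1r mulmx1 mul1mx.
- apply: (@fam_hom k (trivial_mod k)) => z z4 j.
  by rewrite zmodp.big_ord1 /= !(ord1, mxE, eqxx) scale1r mulmx1 mul1mx.
by rewrite cofam_fam zmodp.big_ord1 mulmx1.
Qed.

Lemma retract_unitr M : retract M (tensor M (trivial_mod k)).
Proof.
exists (cofam (fun i => \matrix_(a, _) (a == i)%:R)), (fam (fun i => delta_mx 0 i)); split.
- apply: (@cofam_hom k M (trivial_mod k)) => z z4 j /=.
  apply/matrixP=> a b; rewrite summxE mxE (bigD1 a) //= big1 => [|i /negPf ia].
    rewrite mulmx1 addr0 !mxE eqxx mulr1 (bigD1 j) //= big1 => [|i /negPf ij].
      by rewrite !mxE eqxx addr0 mulr1.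
    by rewrite !mxE ij mulr0.
  by rewrite mulmx1 !mxE eq_sym ia mulr0.
- apply: (@fam_hom k M (trivial_mod k)) => z z4 i /=.
  rewrite -rowE; apply/matrixP=> a b; rewrite summxE mxE (bigD1 b) //= big1.
    by rewrite mul1mx !mxE addr0 !ord1 !eqxx mulr1.
  by move=> j /negPf jb; rewrite mul1mx !mxE [b == j]eq_sym jb andbF mulr0.
rewrite cofam_fam; apply/matrixP=> a b; rewrite summxE (bigD1 b) //= big1.
  by rewrite addr0 !mxE zmodp.big_ord1 !mxE !eqxx mulr1.
by move=> j /negPf jb; rewrite !mxE zmodp.big_ord1 !mxE [b == j]eq_sym jb andbF mulr0.
Qed.

Lemma ideal_of_refl M : ideal_of M M.
Proof. by apply/ideal_ofP; exists (trivial_mod k); apply: retract_unitr. Qed.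

Lemma sub_ideal_of M N : ideal_of N M -> ideal_of M `<=` ideal_of N.
Proof.
move=> NM L /ideal_ofP[W LW]; apply: ideal_of_retract LW; exact: ideal_of_tensor.
Qed.

Lemma ideal_of_trivial : ideal_of (trivial_mod k) = setT.
Proof.
by apply/seteqP; split=> // W _; apply/ideal_ofP; exists W; apply: retract_unitl.
Qed.

Lemma iso_ideal_of M N : iso M N -> ideal_of M = ideal_of N.
Proof.
move=> MN; apply/seteqP; split; apply: sub_ideal_of.
  apply: ideal_of_retract (ideal_of_refl N) _; exact: iso_retract.
apply: ideal_of_retract (ideal_of_refl M) _; apply: iso_retract; exact: iso_sym.
Qed.

End IdealOf.

(** * The group V_4, projectivity and odd dimension *)

Section KleinFour.

Definition g4 : 'Z_2 * 'Z_2 := (1, 0).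
Definition h4 : 'Z_2 * 'Z_2 := (0, 1).

Lemma in_V4 z : z \in V4. Proof. by rewrite inE. Qed.
Hint Resolve in_V4 : core.

(** Keeping the ordered pair of generators abstract allows every later argument to be reused with
    [g4] and [h4] exchanged, which is how the point oo is reached. *)
Definition generators (p q : 'Z_2 * 'Z_2) :=
  forall z, [\/ z = 1%g, z = p, z = q | z = (p * q)%g].

Lemma generators_gh : generators g4 h4.
Proof.
have Z2 (u : 'Z_2) : u = 0 \/ u = 1.
  by case: u => [[|[|?]] ?] //; [left|right]; apply: val_inj.
case=> a b; case: (Z2 a) => ->; case: (Z2 b) => ->;
  [constructor 1|constructor 3|constructor 2|constructor 4];
  by apply: injective_projections; apply: val_inj.
Qed.

Lemma V4_sqr z : (z * z = 1 :> 'Z_2 * 'Z_2)%g.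
Proof.
by case: (generators_gh z) => ->; apply: injective_projections; apply: val_inj.
Qed.

Lemma V4_comm (z w : 'Z_2 * 'Z_2) : (z * w = w * z)%g.
Proof.
rewrite -[LHS]mul1g -(V4_sqr (w * z)) -!mulgA.
by rewrite [(z * (z * w))%g]mulgA V4_sqr mul1g V4_sqr mulg1.
Qed.

Lemma generators_sym p q : generators p q -> generators q p.
Proof.
move=> gen z; case: (gen z) => ->;
  [constructor 1|constructor 3|constructor 2|constructor 4] => //.
exact: V4_comm.
Qed.

Variable k : fieldType.
Implicit Types M N L P W : kV4mod k.

Lemma kV4_sqr M z : M z *m M z = 1%:M.
Proof. by rewrite -repr_mxM // V4_sqr repr_mx1. Qed.

Lemma kV4_comm M z w : M z *m M w = M w *m M z.
Proof. by rewrite -!repr_mxM // V4_comm. Qed.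

Lemma gen_hom p q M N (f : 'M_(rdegree M, rdegree N)) : generators p q ->
  M p *m f = f *m N p -> M q *m f = f *m N q -> is_hom f.
Proof.
move=> gen fp fq z _; case: (gen z) => -> //.
  by rewrite !repr_mx1 mulmx1 mul1mx.
by rewrite !repr_mxM // -mulmxA fq !mulmxA fp.
Qed.

Section KleinModE.
Variables (n : nat) (A B : 'M[k]_n).
Hypotheses (AA : A *m A = 1%:M) (BB : B *m B = 1%:M) (AB : A *m B = B *m A).
Lemma klein_modg : klein_mod AA BB AB g4 = A.
Proof. by rewrite /= /klein_fun /= expr0 expr1 mulmx1. Qed.
Lemma klein_modh : klein_mod AA BB AB h4 = B.
Proof. by rewrite /= /klein_fun /= expr0 expr1 mul1mx. Qed.
End KleinModE.

Lemma trace_hom M N (F : 'M[k]_(rdegree M, rdegree N)) :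
  is_hom (\sum_z M z *m F *m N z).
Proof.
move=> w _; rewrite mulmx_sumr mulmx_suml (reindex_inj (mulgI w)) /=.
apply: eq_bigr => z _.
by rewrite !repr_mxM // !mulmxA kV4_sqr mul1mx -!mulmxA; congr (_ *m (_ *m _)); apply: kV4_comm.
Qed.

(** Higman's criterion: the identity is a transfer from the trivial subgroup, with z in place of
    z^(-1). Unlike the lifting property it visibly passes to retracts and tensor products, and it is
    self-dual. *)
Definition higman P := exists E : 'M[k]_(rdegree P), \sum_z P z *m E *m P z = 1%:M.

Lemma higman_projective P : higman P -> projective P.
Proof.
move=> [E trE] N L p f hp /row_fullP[s sp] hf.
have [p' pp'] : exists p', p' *m p = 1%:M by exists s.
exists (\sum_z P z *m (E *m f *m p') *m N z); first exact: trace_hom.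
rewrite mulmx_suml -[RHS]mul1mx -trE mulmx_suml; apply: eq_bigr => z _.
rewrite -(mulmxA _ (N z)) hp // -!mulmxA; congr (_ *m (_ *m _)).
by rewrite (mulmxA p') pp' mul1mx hf.
Qed.

Lemma higman_injective P : higman P -> injective_module P.
Proof.
move=> [E trE] L N i f hi /row_freeP[i' ii'] hf.
exists (\sum_z N z *m (i' *m f *m E) *m P z); first exact: trace_hom.
rewrite mulmx_sumr -[RHS]mulmx1 -trE mulmx_sumr; apply: eq_bigr => z _.
by rewrite !mulmxA -hi // -(mulmxA _ i) ii' mulmx1 -hf.
Qed.

Lemma higman_retract P Q : higman Q -> retract P Q -> higman P.
Proof.
move=> [E trE] [i [r [hi hr ir]]]; exists (i *m E *m r).
rewrite -ir -{2}[i]mulmx1 -trE mulmx_sumr mulmx_suml; apply: eq_bigr => z _.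
by rewrite !mulmxA hi // -!mulmxA hr.
Qed.

Lemma higman_tensor P W : higman P -> higman (tensor P W).
Proof.
move=> [E trE]; exists (tprod E 1%:M); rewrite -tprod1 -trE tprod_suml.
by apply: eq_bigr => z _; rewrite /= -!tprodE mulmx1 kV4_sqr.
Qed.

Lemma DmodE z i j : Dmod k z i j = (enum_val j == enum_val i * z)%g%:R.
Proof.
rewrite !mxE eqxx /= -(inj_eq enum_val_inj); congr (_ == _)%:R.
by rewrite gring_indexK.
Qed.

(** E projects onto the coordinate of the group element 1; its conjugates project onto the other
    coordinates and add up to the identity. *)
Lemma higman_Dmod : higman (Dmod k).
Proof.
pose i1 := gring_index V4 1%g.
have vi1 : enum_val i1 = 1%g by rewrite gring_indexK.
exists (delta_mx i1 i1); apply/matrixP=> i j; rewrite summxE.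
have E z : (Dmod k z *m delta_mx i1 i1 *m Dmod k z) i j =
    ((enum_val i == z) && (enum_val j == z))%:R.
  rewrite mxE (bigD1 i1) //= big1 => [|l /negPf li].
    rewrite addr0 mxE (bigD1 i1) //= big1 => [|l /negPf li]; last first.
      by rewrite [delta_mx _ _ _ _]mxE li mulr0.
    rewrite addr0 [delta_mx _ _ _ _]mxE !eqxx mulr1 !DmodE vi1 mul1g -natrM mulnb.
    congr ((_ && _)%:R).
    by rewrite -[in RHS](inj_eq (mulIg z)) V4_sqr eq_sym.
  rewrite mxE big1 ?mul0r // => l' _.
  by rewrite [delta_mx _ _ _ _]mxE li andbF mulr0.
rewrite (bigD1 (enum_val i)) //= big1 => [|z /negPf zi]; last by rewrite E eq_sym zi.
by rewrite E eqxx addr0 mxE (inj_eq enum_val_inj) eq_sym.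
Qed.

Lemma row_Dmod z i : \sum_j Dmod k z i j = 1.
Proof.
have -> : 1 = \sum_j (j == gring_index V4 (enum_val i * z)%g)%:R :> k.
  rewrite (bigD1 (gring_index V4 (enum_val i * z)%g)) //= eqxx.
  by rewrite big1 ?addr0 // => j /negPf ->.
by apply: eq_bigr => j _; rewrite !mxE eqxx.
Qed.

Lemma col_Dmod z j : \sum_i Dmod k z i j = 1.
Proof.
rewrite -(row_Dmod z j); apply: eq_bigr => i _; rewrite !DmodE.
congr (_%:R); congr (nat_of_bool _).
by rewrite -(inj_eq (mulIg z)) -mulgA V4_sqr mulg1 eq_sym.
Qed.

(** The augmentation of D tensored with W; [D_inj] is its dual. Through them every W is a quotient
    and a submodule of a module satisfying [higman]. *)
Definition D_proj W : 'M[k]_(#|V4| * rdegree W, rdegree W) := fam (fun _ => 1%:M).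
Definition D_inj W : 'M[k]_(rdegree W, #|V4| * rdegree W) := cofam (fun _ => 1%:M).

Lemma D_proj_hom W : @is_hom k (tensor (Dmod k) W) W (D_proj W).
Proof.
apply: (@fam_hom k (Dmod k)) => z z4 i; rewrite mulmx1 mul1mx -scaler_suml.
by rewrite row_Dmod scale1r.
Qed.

Lemma D_inj_hom W : @is_hom k W (tensor (Dmod k) W) (D_inj W).
Proof.
apply: (@cofam_hom k (Dmod k)) => z z4 i; rewrite mulmx1 mul1mx -scaler_suml.
by rewrite col_Dmod scale1r.
Qed.

Let i1 := gring_index V4 1%g.

Lemma D_proj_full W : row_full (D_proj W).
Proof.
apply/row_fullP; exists (cofam (fun i => if i == i1 then 1%:M else 0)).
rewrite cofam_fam (bigD1 i1) //= eqxx mulmx1 big1 ?addr0 // => i /negPf ->.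
by rewrite mul0mx.
Qed.

Lemma D_inj_free W : row_free (D_inj W).
Proof.
apply/row_freeP; exists (fam (fun i => if i == i1 then 1%:M else 0)).
rewrite cofam_fam (bigD1 i1) //= eqxx mulmx1 big1 ?addr0 // => i /negPf ->.
by rewrite mulmx0.
Qed.

Lemma projective_retract P : projective P -> retract P (tensor (Dmod k) P).
Proof.
move=> prP.
have [f hf fp] := prP _ _ _ _ (@D_proj_hom P) (D_proj_full P) (@is_hom1 _ P).
exists f, (D_proj P); split=> //; exact: D_proj_hom.
Qed.

Lemma injective_retract P : injective_module P -> retract P (tensor (Dmod k) P).
Proof.
move=> inP.
have [f hf fp] := inP _ _ _ _ (@D_inj_hom P) (D_inj_free P) (@is_hom1 _ P).
exists (D_inj P), f; split=> //; exact: D_inj_hom.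
Qed.

Lemma projectiveP P : projective P <-> higman P.
Proof.
split; last exact: higman_projective.
move=> /projective_retract; apply: higman_retract; exact: higman_tensor higman_Dmod.
Qed.

Lemma injective_moduleP P : injective_module P <-> higman P.
Proof.
split; last exact: higman_injective.
move=> /injective_retract; apply: higman_retract; exact: higman_tensor higman_Dmod.
Qed.

Lemma ProjE : Proj k = ideal_of (Dmod k).
Proof.
apply/seteqP; split=> P.
  by move=> /projective_retract PD; apply/ideal_ofP; exists P.
move=> /ideal_ofP[W PDW]; apply/projectiveP; apply: higman_retract PDW.
exact: higman_tensor higman_Dmod.
Qed.

(** M (x) kV_4 is free, the group element z and the basis vector v of M giving (v z) (x) z. The copy
    of D spanned by a single v, of index [j0], is split off by reading the [j0] coordinate of w z on
    w (x) z. *)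
Lemma D_retract M : nonzero M -> retract (Dmod k) (tensor M (Dmod k)).
Proof.
move=> Mgt0.
pose j0 := Ordinal Mgt0.
exists (cofam (fun j => \matrix_(z, w) ((z == w)%:R * M (enum_val w) j0 j))).
exists (fam (fun j => \matrix_(z, w) ((z == w)%:R * M (enum_val z) j j0))).
split.
- apply: (@cofam_hom k M (Dmod k)) => z z4 j.
  apply/matrixP=> a b; rewrite summxE [RHS]mxE [RHS](bigD1 b) //= [X in _ = _ + X]big1 => [|c /negPf cb].
    rewrite addr0 DmodE [in RHS]mxE eqxx mul1r.
    under eq_bigr => i _.
      rewrite !mxE (bigD1 a) //= big1 => [|c /negPf ca]; last first.
        by rewrite !mxE eq_sym ca mul0r mul0r.
      rewrite addr0 DmodE mxE eqxx mul1r; over.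
    have [e|_] := eqVneq (enum_val b) (enum_val a * z)%g; last first.
      by rewrite mul0r big1 // => i _; rewrite !mulr0.
    rewrite mul1r e repr_mxM // mxE; apply: eq_bigr => i _.
    by rewrite mulr1 mulrC.
  by rewrite [X in _ * X]mxE cb mul0r mulr0.
- apply: (@fam_hom k M (Dmod k)) => z z4 i.
  apply/matrixP=> a b; rewrite summxE [RHS]mxE [RHS](bigD1 a) //= [X in _ = _ + X]big1 => [|c /negPf cb].
    rewrite addr0 DmodE [X in _ = X * _]mxE eqxx mul1r.
    under eq_bigr => j _.
      rewrite !mxE (bigD1 b) //= big1 => [|c /negPf ca]; last first.
        by rewrite !mxE ca mul0r mulr0.
      rewrite addr0 DmodE mxE eqxx mul1r; over.
    have [e|_] := eqVneq (enum_val b) (enum_val a * z)%g; last first.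
      by rewrite mulr0 big1 // => j _; rewrite mul0r !mulr0.
    have -> : enum_val a = (z * enum_val b)%g by rewrite e V4_comm -mulgA V4_sqr mulg1.
    rewrite repr_mxM // mxE mulr1; apply: eq_bigr => j _.
    by rewrite mul1r.
  by rewrite [X in X * _]mxE eq_sym cb mul0r mul0r.
rewrite cofam_fam; apply/matrixP=> a b; rewrite summxE mxE.
under eq_bigr => j _.
  rewrite !mxE (bigD1 a) //= big1 => [|c /negPf ca]; last first.
    by rewrite !mxE eq_sym ca !mul0r.
  rewrite addr0 !mxE eqxx mul1r mulrCA; over.
rewrite -mulr_sumr; have := kV4_sqr M (enum_val a) => /matrixP/(_ j0 j0).
by rewrite !mxE eqxx => ->; rewrite mulr1.
Qed.

Lemma Proj_sub_ideal (I : set (kV4mod k)) :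
  tensor_ideal I -> (exists2 M, I M & nonzero M) -> Proj k `<=` I.
Proof.
move=> [Isum Itens] [M IM nzM]; rewrite ProjE => P [W PW].
apply: (Isum _ _ _ PW); apply: (Itens); apply: (Isum _ _ (Itens _ (Dmod k) IM)).
by apply/summandP; apply: D_retract.
Qed.

Section Char2.
Hypothesis char2 : 2%N \in [pchar k].

Lemma addmm m n (A : 'M[k]_(m, n)) : A + A = 0.
Proof. by apply/matrixP=> i j; rewrite !mxE -mulr2n (mulrn_pchar char2). Qed.

Lemma higman_even P : higman P -> (rdegree P)%:R = 0 :> k.
Proof.
move=> [E trE]; rewrite -mxtrace1 -trE linear_sum /=.
under eq_bigr => z _ do rewrite mxtrace_mulC mulmxA kV4_sqr mul1mx.
rewrite sumr_const card_prod !card_ord /= -mulr_natr.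
by rewrite natrM (pcharf0 char2) !mul0r mulr0.
Qed.

(** Coevaluation from k to M (x) M' followed by evaluation is multiplication by dim M. Since V_4 is
    abelian of exponent 2, transposition without inversion already gives the dual M'. *)
Lemma oddmx_ideal_of M : (rdegree M)%:R != 0 :> k -> ideal_of M = setT.
Proof.
move=> oddM; rewrite -ideal_of_trivial.
have dual_repr : mx_repr V4 (fun z => (M z)^T).
  split=> [|z w _ _]; first by rewrite repr_mx1 trmx1.
  by rewrite repr_mxM // kV4_comm trmx_mul.
pose M' : kV4mod k := Representation (MxRepresentation dual_repr).
apply/seteqP; split=> [|]; first by rewrite ideal_of_trivial.
apply: sub_ideal_of; apply/ideal_ofP; exists M'.
exists (cofam (fun i : 'I_(rdegree M) => delta_mx 0 i : 'M[k]_(1, rdegree M))).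
exists (fam (fun i : 'I_(rdegree M) =>
  (rdegree M)%:R^-1 *: delta_mx i 0 : 'M[k]_(rdegree M, 1))); split.
- apply: (@cofam_hom k M M') => z z4 j; rewrite mul1mx.
  apply/matrixP=> a b; rewrite summxE.
  have := kV4_sqr M z => /matrixP/(_ b j).
  rewrite !mxE !ord1 eqxx /= eq_sym => <-; apply: eq_bigr => i _.
  rewrite mulrC mxE; congr (_ * _); rewrite !mxE (bigD1 i) //= !mxE !eqxx mul1r.
  by rewrite big1 ?addr0 // => c /negPf ci; rewrite !mxE ci andbF mul0r.
- apply: (@fam_hom k M M') => z z4 i; rewrite mulmx1.
  under eq_bigr => j _ do rewrite -scalemxAr scalerA mulrC -scalerA.
  rewrite -scaler_sumr; congr (_ *: _).
  apply/matrixP=> a b; rewrite summxE.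
  have := kV4_sqr M z => /matrixP/(_ i a).
  rewrite !mxE !ord1 eqxx andbT eq_sym => <-; apply: eq_bigr => j _.
  rewrite mxE; congr (_ * _); rewrite !mxE (bigD1 j) //= !mxE !eqxx mulr1.
  by rewrite big1 ?addr0 // => c /negPf ci; rewrite !mxE ci mulr0.
rewrite cofam_fam.
under eq_bigr => i _ do rewrite -scalemxAr mul_delta_mx.
rewrite sumr_const card_ord -scaler_nat scalerA mulfV // scale1r.
by apply/matrixP=> a b; rewrite !mxE !ord1.
Qed.

End Char2.
End KleinFour.
#[global] Hint Resolve in_V4 : core.

(** * The endomorphism t and its powers up to stably zero maps *)

Section Killed.
Variable k : fieldType.
Hypothesis char2 : 2%N \in [pchar k].
Implicit Types M N L P W : kV4mod k.

Lemma oppmm m n (A : 'M[k]_(m, n)) : - A = A.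
Proof. by apply/eqP; rewrite -subr_eq0 -opprD addmm // oppr0. Qed.

Lemma addmmK m n (A B : 'M[k]_(m, n)) : A + B + B = A.
Proof. by rewrite -addrA addmm // addr0. Qed.

Variables (p q : 'Z_2 * 'Z_2).
Hypothesis gen : generators p q.

(* When M or N is free over k<p>, this means that f vanishes in the stable
   category. *)
Definition stably0 M N (f : 'M[k]_(rdegree M, rdegree N)) :=
  exists d, M p *m d = d *m N p /\ f = d + M q *m d *m N q.

Definition stab_op M (e : 'M[k]_(rdegree M)) := e + M q *m e *m M q.

Definition split_idem M (e : 'M[k]_(rdegree M)) := e + M p *m e *m M p = 1%:M.

(** The exponent 0 is allowed: it asks the identity to be stably zero, and projective modules
    satisfy it. *)
Definition killed (b : k) (n : nat) M :=
  exists e, split_idem e /\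
    @stably0 M M ((stab_op e - b%:M : 'M_(rdegree M)) ^+ n).

Lemma stably0D M N (f g : 'M_(rdegree M, rdegree N)) :
  stably0 f -> stably0 g -> stably0 (f + g).
Proof.
move=> [d [cd ->]] [d' [cd' ->]]; exists (d + d'); split.
  by rewrite mulmxDr mulmxDl cd cd'.
by rewrite mulmxDr mulmxDl addrACA.
Qed.

Lemma stably0_mul M N M' N' (f : 'M_(rdegree M, rdegree N))
    (a : 'M_(rdegree M', rdegree M)) (b : 'M_(rdegree N, rdegree N')) :
  is_hom a -> is_hom b -> stably0 f -> stably0 (a *m f *m b).
Proof.
move=> ha hb [d [cd ->]]; exists (a *m d *m b); split.
  by rewrite !mulmxA ha // -!mulmxA -hb // (mulmxA d) -cd !mulmxA.
rewrite mulmxDr mulmxDl; congr (_ + _).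
by rewrite !mulmxA -ha // -!mulmxA hb.
Qed.

Lemma split_idemP M (e : 'M_(rdegree M)) :
  split_idem e -> M p *m e = M p + e *m M p.
Proof.
move=> he; have := congr1 (fun A => A *m M p) he.
rewrite mulmxDl mul1mx -!mulmxA kV4_sqr mulmx1 => E.
by apply: (addIr (e *m M p)); rewrite addmmK addrC.
Qed.

Lemma stab_opq M (e : 'M_(rdegree M)) : e *m M q = M q *m stab_op e + M q *m e.
Proof.
rewrite /stab_op mulmxDr !mulmxA kV4_sqr mul1mx.
by rewrite addrAC addmm // add0r.
Qed.

(** By [split_idemP], e commutes with the action of p up to the error [M p]. Its conjugate by q has
    the same error, and the two cancel in characteristic 2; conjugation by q only exchanges the two
    summands of t. *)
Lemma stab_op_hom M (e : 'M_(rdegree M)) :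
  split_idem e -> @is_hom _ M M (stab_op e).
Proof.
move=> he; apply: (gen_hom gen); rewrite /stab_op mulmxDr mulmxDl.
  rewrite split_idemP // !mulmxA (kV4_comm M p q) -(mulmxA _ (M p)) split_idemP //.
  rewrite mulmxDr mulmxDl (kV4_comm M q p) -!mulmxA kV4_sqr mulmx1 (kV4_comm M p q).
  by rewrite addrACA addmm // add0r.
by rewrite !mulmxA kV4_sqr mul1mx -!mulmxA kV4_sqr mulmx1 addrC.
Qed.

Lemma exp_hom M (T : 'M_(rdegree M)) n : @is_hom _ M M T -> @is_hom _ M M (T ^+ n).
Proof.
move=> hT; elim: n => [|n IH]; first exact: is_hom1.
by rewrite exprS; apply: (@is_hom_mul _ M M M).
Qed.

Lemma subscalar_hom M (T : 'M_(rdegree M)) b :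
  @is_hom _ M M T -> @is_hom _ M M (T - b%:M).
Proof. by move=> hT z z4; rewrite mulmxBr mulmxBl hT // scalar_mxC. Qed.

Lemma tprod_exp m n (A : 'M[k]_m) j :
  (tprod A (1%:M : 'M_n)) ^+ j = tprod (A ^+ j) 1%:M.
Proof.
elim: j => [|j IH]; first by rewrite expr0 -[1 in LHS]/(1%:M) -tprod1.
by rewrite !exprS IH -[LHS]/(_ *m _) -tprodE mulmx1.
Qed.

Lemma killed_tensor b n M W : killed b n M -> killed b n (tensor M W).
Proof.
move=> [e [he [d [cd ed]]]].
have conj1 z f : tensor M W z *m tprod f 1%:M *m tensor M W z =
    tprod (M z *m f *m M z) 1%:M.
  by rewrite /= -!tprodE mulmx1 kV4_sqr.
exists (tprod e 1%:M); split.
  by rewrite /split_idem conj1 -tprodDl he tprod1.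
exists (tprod d 1%:M); split; first by rewrite /= -!tprodE cd mulmx1 mul1mx.
rewrite /stab_op !conj1 -!tprodDl -[RHS]/(tprod _ _) -ed -tprod_exp; congr (_ ^+ n).
rewrite -[X in _ - X%:M]mulr1 -scale_scalar_mx -tprod1 -tprodZl -scaleN1r -tprodZl.
by rewrite -tprodDl scaleN1r scale_scalar_mx mulr1.
Qed.

(** The compression i e r is a valid choice for N, but powers do not commute with compression. The
    discrepancy comes from the commutator of t with the idempotent r i, and this commutator is
    stably zero. *)
Lemma killed_retract b n M N : retract N M -> killed b n M -> killed b n N.
Proof.
move=> [i [r [hi hr ir]]] [e [he Ze]].
have sand z f : N z *m (i *m f *m r) *m N z = i *m (M z *m f *m M z) *m r.
  by rewrite !mulmxA hi // -!mulmxA hr.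
exists (i *m e *m r); split.
  by rewrite /split_idem sand -mulmxDl -mulmxDr he mulmx1 ir.
have tE : stab_op (M := N) (i *m e *m r) = i *m stab_op e *m r.
  by rewrite /stab_op sand -mulmxDl -mulmxDr.
rewrite tE; set t := stab_op e in Ze *.
have ht : @is_hom _ M M t by apply: stab_op_hom.
set T := t - b%:M in Ze; set T' := _ - b%:M.
have hT : @is_hom _ M M T by apply: subscalar_hom.
have hT' : @is_hom _ N N T'.
  by apply: subscalar_hom; apply: is_hom_mul hr; apply: is_hom_mul hi ht.
have T'i : T' *m i = i *m T + i *m (t *m (r *m i) + r *m i *m t) *m 1%:M.
  rewrite mulmx1 mulmxDr !mulmxA ir mul1mx mulmxBl mulmxBr.
  rewrite -scalar_mxC -[in RHS]addrA; rewrite [- _ + _]addrC -[_ + i *m t - _]addrA.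
  by rewrite addrCA [_ + (i *m t - _)]addrA addmm // add0r.
have Zc : @stably0 M M (t *m (r *m i) + r *m i *m t).
  have : @is_hom _ M M (r *m i) by apply: is_hom_mul.
  move: (r *m i) => c hc.
  (* The errors of e c and c e against p are [M p] times c and c times [M p]; they cancel because c
     is equivariant. *)
  exists (e *m c + c *m e); split.
    rewrite mulmxDr mulmxDl !mulmxA (hc p) // split_idemP // -(mulmxA c (M p)).
    rewrite split_idemP // mulmxDl mulmxDr -(mulmxA e (M p)) (hc p) // !mulmxA.
    by rewrite addrACA addmm // add0r.
  rewrite /t /stab_op !(mulmxDr, mulmxDl) !mulmxA addrACA; congr (_ + _ + (_ + _)).
    by rewrite -!mulmxA hc.
  by rewrite hc.
move: (t *m _ + _) T'i Zc => c T'i Zc.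
(* Each multiplication by T' on the left moves i one step further at the cost of one more stably
   zero term. *)
clearbody T' T; have [y ey Zy] : exists2 y, T' ^+ n = i *m T ^+ n *m r + y & @stably0 N N y.
  elim: n {Ze} => [|n [y ey Zy]].
    exists 0; first by rewrite !expr0 mulmx1 ir addr0.
    by exists 0; rewrite !(mulmx0, mul0mx, addr0).
  exists (i *m c *m (T ^+ n *m r) + T' *m y *m 1%:M).
    rewrite exprS ey -[LHS]/(T' *m _) mulmxDr !mulmxA T'i !mulmx1 !mulmxDl addrA.
    by rewrite exprS -[T * _]/(T *m _) !mulmxA.
  apply: stably0D; last by apply: stably0_mul Zy => //; exact: is_hom1.
  apply: stably0_mul => //; apply: is_hom_mul hr; exact: exp_hom.
by rewrite ey; apply: stably0D Zy; apply: stably0_mul.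
Qed.

Lemma killed_ideal_of b n M N : killed b n M -> ideal_of M N -> killed b n N.
Proof.
move=> kM /ideal_ofP[W NW]; apply: killed_retract NW _; exact: killed_tensor.
Qed.

(** The two terms of e + p e p have the same trace. *)
Lemma killed_even b n M : killed b n M -> (rdegree M)%:R = 0 :> k.
Proof.
move=> [e [he _]]; rewrite -mxtrace1 -he mxtraceD mxtrace_mulC mulmxA kV4_sqr mul1mx.
by rewrite -mulr2n (mulrn_pchar char2).
Qed.

Lemma sum_delta (T : lmodType k) m (a : 'I_m) (F : 'I_m -> T) :
  \sum_b (a == b)%:R *: F b = F a.
Proof.
rewrite (bigD1 a) //= eqxx scale1r big1 ?addr0 // => b /negPf.
by rewrite eq_sym => ->; rewrite scale0r.
Qed.

(* The V_n(b) part of the retraction: in terms of the basis f_i, e_i of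
   V_n(b), with x e_i = f_i and y e_i = b f_i + f_(i-1), it sends f_i (x) w to
   T^(n-1-i) w and e_i (x) w to e T^(n-1-i) w, where T = t - b; the condition
   at i = 0 is T^n = 0, which is corrected by d. *)
Lemma killed_retract_V b n M (V : mx_representation k V4 (n.+1 + n.+1)) :
  V p = block_mx 1%:M 0 1%:M 1%:M ->
  V q = block_mx 1%:M 0 (Jordan n.+1 b)^T 1%:M ->
  killed b n.+1 M -> retract M (tensor (Representation V) M).
Proof.
move=> Vp Vq [e [he [d [cd ed]]]].
set t := stab_op e in ed; set T := t - b%:M in ed.
have ht : @is_hom _ M M t by apply: stab_op_hom.
have hT j : @is_hom _ M M (T ^+ j) by apply/exp_hom/subscalar_hom.
pose P (i : 'I_(n.+1 + n.+1)) := match split i with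
  | inl a => T ^+ (n - a)
  | inr a => e *m T ^+ (n - a) + (a == ord0)%:R *: d end.
have Pl a : P (lshift _ a) = T ^+ (n - a) by rewrite /P (unsplitK (inl _ a)).
have Pr a : P (rshift _ a) = e *m T ^+ (n - a) + (a == ord0)%:R *: d.
  by rewrite /P (unsplitK (inr _ a)).
(* The section sends w to f (x) w for the last socle vector f, the one to which P assigns T^0 = 1;
   it is equivariant because socle vectors are fixed by the group. *)
pose Q (j : 'I_(n.+1 + n.+1)) : 'M[k]_(rdegree M) :=
  (lshift n.+1 ord_max == j)%:R *: 1%:M.
exists (cofam Q), (fam P); split.
- have aux z B : V z = block_mx 1%:M 0 B 1%:M ->
      M z *m cofam Q = cofam Q *m tensor (Representation V) M z.
    move=> Vz; rewrite cofam_tprod mul_cofam; apply: eq_cofam => j.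
    under eq_bigr => i _ do
      rewrite /Q -scalemxAl mul1mx scalerA mulrC -scalerA.
    rewrite sum_delta /Q /= Vz -scalemxAr mulmx1; congr (_ *: _).
    case: (split_ordP j) => a ->; first by rewrite block_mxEul mxE eq_lshift.
    by rewrite block_mxEur mxE eq_lrshift.
  by apply: (gen_hom gen); [exact: aux Vp|exact: aux Vq].
- apply: (gen_hom gen); rewrite tprod_fam fam_mul; apply: eq_fam => i /=;
    rewrite big_split_ord /= (Vp, Vq); case: (split_ordP i) => a ->.
  + under eq_bigr => j _ do rewrite block_mxEul mxE.
    rewrite sum_delta Pl big1 ?addr0; first by rewrite hT.
    by move=> j _; rewrite block_mxEur mxE scale0r.
  + under eq_bigr => j _ do rewrite block_mxEdl mxE.
    under [X in _ + X]eq_bigr => j _ do rewrite block_mxEdr mxE.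
    rewrite !sum_delta Pl Pr mulmxDr mulmxDl -scalemxAr -scalemxAl cd mulmxA.
    rewrite (split_idemP he) mulmxDl !addrA addmm // add0r; congr (_ + _).
    by rewrite -!mulmxA hT.
  + under eq_bigr => j _ do rewrite block_mxEul mxE.
    rewrite sum_delta Pl big1 ?addr0; first by rewrite hT.
    by move=> j _; rewrite block_mxEur mxE scale0r.
  under eq_bigr => j _ do rewrite block_mxEdl.
  under [X in _ + X]eq_bigr => j _ do rewrite block_mxEdr mxE.
  rewrite sum_delta.
  have -> : \sum_(j < n.+1) (Jordan n.+1 b)^T a j *: (M q *m P (lshift n.+1 j)) =
      M q *m (b *: T ^+ (n - a) + (a != ord0)%:R *: T ^+ (n - a).+1).
    rewrite (bigD1 a) //= Pl !mxE eqxx mulmxDr -scalemxAr; congr (_ + _).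
    have [a0|a0] := eqVneq a ord0.
      rewrite scale0r mulmx0 big1 // => j /negPf ja; rewrite !mxE ja a0 /=.
      by rewrite scale0r.
    have lt_a : (a.-1 < n.+1)%N by apply: leq_ltn_trans (leq_pred _) (ltn_ord a).
    have a_gt0 : (0 < a)%N by rewrite lt0n; apply: contra a0.
    rewrite (bigD1 (Ordinal lt_a)) /=; last first.
      by rewrite -val_eqE /= neq_ltn prednK ?leqnn.
    rewrite Pl !mxE -val_eqE /= prednK // eqxx.
    rewrite (ltn_eqF (_ : (a.-1 < a)%N)) ?prednK // scale1r scale1r big1 ?addr0.
      by rewrite -subSn -1?ltnS ?prednK ?ltn_ord //= -[in RHS](prednK a_gt0) subSS.
    move=> j /andP[/negPf ja /negPf ja']; rewrite !mxE ja.
    suff -> : (a == j.+1 :> nat) = false by rewrite scale0r.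
    by apply/negP=> /eqP aj; move: ja'; rewrite -val_eqE /= aj /= eqxx.
  rewrite Pr mulmxDr mulmxDl !mulmxA -[e *m _ *m _]mulmxA -hT // mulmxA stab_opq -/t !mulmxDl.
  have -> : M q *m t *m T ^+ (n - a) =
      M q *m T ^+ (n - a).+1 + b *: (M q *m T ^+ (n - a)).
    rewrite -mulmxA -[t](subrK b%:M) -/T mulmxDl mul_scalar_mx exprS.
    by rewrite mulmxDr scalemxAr.
  rewrite mulmxDr -scalemxAl -!scalemxAr.
  have [->|_] := eqVneq a ord0; last first.
    by rewrite !scale0r !addr0 scale1r [b *: _ + _]addrC.
  (* At the index 0 there is no preceding socle vector to account for T^(n+1); this power is
     replaced by d + q d q, and the summand d in P absorbs it. *)
  rewrite scale0r addr0 !scale1r subn0 ed mulmxDr !mulmxA kV4_sqr mul1mx.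
  rewrite -!addrA; set x1 := M q *m d; set x2 := d *m M q.
  rewrite [X in _ = x1 + X]addrC [X in _ = x1 + (X + _)]addrA addmmK //.
  by rewrite addrA addrC.
rewrite cofam_fam (bigD1 (lshift n.+1 ord_max)) //= Pl subnn expr0 mulmx1.
rewrite big1 => [|j /negPf jm]; first by rewrite /Q eqxx scale1r addr0.
by rewrite /Q eq_sym jm scale0r mul0mx.
Qed.

End Killed.

(** * Exponents of the modules V_n *)

Section VModuleIdeals.
Variable k : fieldType.
Hypothesis char2 : 2%N \in [pchar k].
Implicit Types M N L P W : kV4mod k.

Section TwoByTwo.
Variables (p q : 'Z_2 * 'Z_2) (gen : generators p q).

(** The lower left block is the derivative of the j-th power at A in direction C. The value [j.-1]
    at j = 0 is harmless, its coefficient being 0. *)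
Lemma lower_exp n (A C : 'M[k]_n) j : A *m C = C *m A ->
  (block_mx A 0 C A : 'M_(n + n)) ^+ j =
  block_mx (A ^+ j) 0 (j%:R *: (C *m A ^+ j.-1)) (A ^+ j).
Proof.
move=> AC; elim: j => [|j IH].
  by rewrite !expr0 scale0r -[1 in LHS]/(1%:M) scalar_mx_block.
rewrite exprS IH -[LHS]/(_ *m _) mulmx_block !mul0mx !mulmx0 !addr0 add0r !exprS.
congr block_mx; rewrite -scalemxAr.
have -> : j%:R *: (A *m (C *m A ^+ j.-1)) = j%:R *: (C *m A ^+ j).
  by case: j {IH} => [|j]; rewrite ?scale0r // exprS mulmxA AC -mulmxA.
by rewrite -{1}[C *m _]scale1r -scalerDl -natr1 addrC.
Qed.

(* With e as below, t is the matrix [B, 0; B^2 + B, B]. *)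
Lemma killed_lower n (V : mx_representation k V4 (n + n)) (B D : 'M[k]_n) b j :
  V p = block_mx 1%:M 0 1%:M 1%:M -> V q = block_mx 1%:M 0 B 1%:M ->
  (B - b%:M) ^+ j = 0 ->
  j%:R *: ((B *m B + B) *m (B - b%:M) ^+ j.-1) = D *m B + B *m D ->
  killed p q b j (Representation V).
Proof.
move=> Vp Vq Aj CD; set A := B - b%:M in Aj CD.
pose e : 'M[k]_(n + n) := block_mx 0 1%:M 0 1%:M.
exists e; split.
  rewrite /split_idem /= Vp /e !mulmx_block !(mul0mx, mulmx0, mul1mx, mulmx1, add0r, addr0).
  by rewrite !add_block_mx !(add0r, addr0) !addmm // addr0 -scalar_mx_block.
(* For d = diag(D, D), the map d + q d q has as its only block the commutator of B and D, in the
   lower left corner. *)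
exists (block_mx D 0 0 D); split=> /=.
  by rewrite Vp !mulmx_block !(mul0mx, mulmx0, mul1mx, mulmx1, add0r, addr0).
have -> : stab_op q (M := Representation V) e - b%:M = block_mx A 0 (B *m B + B) A.
  rewrite /stab_op /= Vq /e !mulmx_block !(mul0mx, mulmx0, mul1mx, mulmx1, add0r, addr0).
  rewrite scalar_mx_block opp_block_mx !add_block_mx !(add0r, addr0, oppr0) mulmxDl mul1mx.
  by rewrite addmm // [1%:M + (_ + _)]addrCA addmm // addr0.
rewrite lower_exp; last first.
  by rewrite /A mulmxBl mulmxBr scalar_mxC mulmxDr mulmxDl mulmxA.
rewrite Aj CD Vq !mulmx_block !(mul0mx, mulmx0, mul1mx, mulmx1, add0r, addr0).
by rewrite !add_block_mx !(add0r, addr0) !addmm // addrC.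
Qed.

(** Whatever e is chosen, its relation with p forces its upper right block Z to be the inverse of X,
    so the upper left block of t is Z Y. A map d commuting with p has upper right block 0, hence d +
    q d q has upper left block 0: a stably zero power of t - b must vanish there. *)
Lemma killed_obstruction a c (M : mx_representation k V4 (c + a)) (X Y : 'M[k]_(a, c)) b j :
  M p = block_mx 1%:M 0 X 1%:M -> M q = block_mx 1%:M 0 Y 1%:M ->
  killed p q b j (Representation M) ->
  exists Z, [/\ Z *m X = 1%:M, X *m Z = 1%:M & (Z *m Y - b%:M) ^+ j = 0].
Proof.
move=> Mp Mq [e [he [d [cd ed]]]].
rewrite /= in e he d cd ed.
pose Z : 'M_(c, a) := ursubmx e; pose d12 : 'M_(c, a) := ursubmx d.
have addK m n (A B : 'M[k]_(m, n)) : A = B + A -> B = 0.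
  by move/eqP; rewrite -subr_eq subrr => /eqP.
have eE := submxK (e : 'M_(c + a)); rewrite -/Z in eE.
have dE := submxK (d : 'M_(c + a)); rewrite -/d12 in dE.
have := split_idemP char2 he; rewrite /= Mp -{1 2}eE.
rewrite !mulmx_block !(mul0mx, mulmx0, mul1mx, mulmx1, add0r, addr0) add_block_mx.
case/eq_block_mx => e11 _ _ e22.
have ZX : Z *m X = 1%:M.
  apply/eqP; rewrite eq_sym -subr_eq0 oppmm //; apply/eqP.
  by apply: (addK _ _ (ulsubmx e)); rewrite -addrA [Z *m X + _]addrC -e11.
have XZ : X *m Z = 1%:M.
  by apply: (addIr (drsubmx e)); rewrite e22.
have d0 : d12 = 0.
  move: cd; rewrite Mp -{1 2}dE.
  rewrite !mulmx_block !(mul0mx, mulmx0, mul1mx, mulmx1, add0r, addr0).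
  case/eq_block_mx; rewrite [_ + d12 *m X]addrC => /addK d12X _ _ _.
  by rewrite -[d12]mulmx1 -XZ mulmxA d12X mul0mx.
exists Z; split=> //.
have [C [D tE]] : exists C D, stab_op q (M := Representation M) e - b%:M =
    block_mx (Z *m Y - b%:M) 0 C D.
  rewrite /stab_op /= Mq -eE !mulmx_block.
  rewrite !(mul0mx, mulmx0, mul1mx, mulmx1, add0r, addr0) !add_block_mx.
  rewrite scalar_mx_block opp_block_mx add_block_mx oppr0 addr0 [Z + Z]addmm //.
  rewrite addrA addmm // add0r; eexists; eexists; reflexivity.
have [C' [D' pE]] : exists C' D', (block_mx (Z *m Y - b%:M) 0 C D) ^+ j =
    block_mx ((Z *m Y - b%:M) ^+ j) 0 C' D'.
  elim: j {ed} => [|j [C' [D' IH]]].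
    by exists 0, 1%:M; rewrite expr0 -[LHS]/(1%:M) scalar_mx_block.
  exists (C *m (Z *m Y - b%:M) ^+ j + D *m C'), (D *m D').
  rewrite exprS IH -[LHS]/(_ *m _) mulmx_block !mul0mx !mulmx0 !addr0 !add0r.
  by rewrite exprS.
move: ed; rewrite tE pE Mq -dE d0 !mulmx_block.
rewrite !(mul0mx, mulmx0, mul1mx, mulmx1, add0r, addr0) add_block_mx.
by case/eq_block_mx => -> _ _ _; rewrite addmm.
Qed.

End TwoByTwo.

Definition N_ n : 'M[k]_n := (Jordan n 0)^T.

Lemma Jordan_tr n a : (Jordan n a)^T = N_ n + a%:M :> 'M[k]_n.
Proof.
apply/matrixP=> i j; rewrite !mxE [j == i]eq_sym.
by case: eqVneq => _; rewrite ?add0r ?addr0.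
Qed.

Lemma N_E n (i j : 'I_n) : N_ n i j = (i == j.+1 :> nat)%:R.
Proof.
rewrite !mxE; have [->|//] := eqVneq j i.
by rewrite (ltn_eqF (ltnSn i)).
Qed.

Lemma N_exp n j (i l : 'I_n) : (N_ n ^+ j) i l = (i == (l + j)%N :> nat)%:R.
Proof.
elim: j l => [|j IH] l; first by rewrite expr0 mxE addn0.
rewrite exprSr mxE; have [lt_l|ge_l] := ltnP l.+1 n.
  rewrite (bigD1 (Ordinal lt_l)) //= big1 => [|m /negPf ml].
    by rewrite IH N_E /= eqxx mulr1 addr0 addnS addSn.
  rewrite N_E; have -> : (m == l.+1 :> nat) = false by rewrite -ml.
  by rewrite mulr0.
rewrite big1 => [|m _].
  have [e|//] := eqVneq (i : nat) (l + j.+1)%N.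
  by have := ltn_ord i; rewrite e ltnNge (leq_trans ge_l) // addnS ltnS leq_addr.
rewrite N_E; have [e|] := eqVneq (m : nat) l.+1; last by rewrite mulr0.
by have := ltn_ord m; rewrite e ltnNge ge_l.
Qed.

Lemma N_nilpotent n j : (n <= j)%N -> N_ n ^+ j = 0.
Proof.
move=> nj; apply/matrixP=> i l; rewrite N_exp mxE.
have [e|//] := eqVneq (i : nat) (l + j)%N.
by have := ltn_ord i; rewrite e ltnNge (leq_trans nj) // leq_addl.
Qed.

Lemma N_exp_neq0 n j : (j < n)%N -> N_ n ^+ j != 0.
Proof.
move=> jn; have n0 : (0 < n)%N by apply: leq_ltn_trans jn.
apply/eqP=> /matrixP /(_ (Ordinal jn) (Ordinal n0)).
by rewrite N_exp mxE /= eqxx => /eqP; rewrite oner_eq0.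
Qed.

(** D is the grading operator and N shifts degrees by one, so N is its own commutator with D, up to
    a sign invisible here. This makes N^(n-1) a commutator as well. *)
Lemma N_diag n (D := diag_mx (\row_(i < n) i%:R) : 'M[k]_n) :
  D *m N_ n + N_ n *m D = N_ n.
Proof.
have NE := N_E (n := n); rewrite /D; move: (N_ n) NE => N NE.
apply/matrixP=> i j; rewrite mxE mul_diag_mx mul_mx_diag !mxE NE.
case: eqP => [->|_]; last by rewrite mulr0 mul0r addr0.
by rewrite mulr1 mul1r -natr1 addrAC -mulr2n (mulrn_pchar char2) add0r.
Qed.

(** With the generators ordered by c, the module V_n(oo) has the same matrices as V_n(0); hence the
    eigenvalue 0 at [None]. *)
Definition gen1 (c : option k) := if c is Some _ then g4 else h4.
Definition gen2 (c : option k) := if c is Some _ then h4 else g4.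
Definition eig (c : option k) := if c is Some a then a else 0.

Lemma gens12 c : generators (gen1 c) (gen2 c).
Proof. by case: c => [a|]; [|apply: generators_sym]; apply: generators_gh. Qed.

Lemma Vmod_gen1 n c : Vmod char2 n c (gen1 c) = block_mx 1%:M 0 1%:M 1%:M.
Proof.
case: c => [a|]; rewrite (klein_modg, klein_modh) /Vg /Vh /Vx /Vy (scalar_mx_block n n) add_block_mx;
  by rewrite !(addr0, add0r) tr_block_mx !trmx1 trmx0.
Qed.

Lemma Vmod_gen2 n c :
  Vmod char2 n c (gen2 c) = block_mx 1%:M 0 (Jordan n (eig c))^T 1%:M.
Proof.
case: c => [a|]; rewrite (klein_modg, klein_modh) /Vg /Vh /Vx /Vy (scalar_mx_block n n) add_block_mx;
  by rewrite !(addr0, add0r) tr_block_mx !trmx1 trmx0.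
Qed.

(** The F_2-rational points of the projective line, oo included. *)
Definition rational (c : option k) := (eig c == 0) || (eig c == 1).

Lemma Vmod_killed n c j : (n < j)%N || (0 < n)%N && (n == j) && (rational c || (1 < n)%N) ->
  killed (gen1 c) (gen2 c) (eig c) j (Vmod char2 n c).
Proof.
move=> nj; set B := (Jordan n (eig c))^T.
have BN : B - (eig c)%:M = N_ n by rewrite /B Jordan_tr addrK.
have le_nj : (n <= j)%N.
  by case/orP: nj => [/ltnW //|/andP[/andP[_ /eqP ->]]].
have lower := killed_lower (Vmod_gen1 n c) (Vmod_gen2 n c) (b := eig c).
rewrite -/B in lower.
have QE : B *m B + B = N_ n *m N_ n + N_ n + (eig c ^+ 2 + eig c)%:M.
  rewrite /B Jordan_tr mulmxDl !mulmxDr scalar_mxC -scalar_mxM.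
  rewrite raddfD /= -!addrA; congr (_ + _); rewrite addrA addmm // add0r expr2.
  by rewrite addrCA.
have [lt_nj|] := ltnP n j.
  apply: (lower 0); rewrite BN; first exact: N_nilpotent.
  rewrite N_nilpotent ?mulmx0 ?mul0mx ?scaler0 ?addr0 //.
  by case: j lt_nj {nj le_nj}.
move=> le_jn; have {le_nj le_jn} ej : j = n by apply/eqP; rewrite eqn_leq le_jn.
subst j; move: nj; rewrite ltnn eqxx andbT /= => /andP[n_gt0 rat].
have QN : (B *m B + B) *m N_ n ^+ n.-1 = (eig c ^+ 2 + eig c) *: N_ n ^+ n.-1.
  rewrite QE !mulmxDl mul_scalar_mx -mulmxA.
  have -> : N_ n *m N_ n ^+ n.-1 = 0.
    by rewrite -[LHS]/(N_ n * _) -exprS prednK // N_nilpotent.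
  by rewrite mulmx0 !add0r.
have [r|] := boolP (rational c).
  apply: (lower 0); rewrite BN; [exact: N_nilpotent|rewrite QN].
  have -> : eig c ^+ 2 + eig c = 0.
    case/orP: r => /eqP ->; first by rewrite expr0n addr0.
    by rewrite expr1n -mulr2n (mulrn_pchar char2).
  by rewrite scale0r scaler0 mul0mx mulmx0 addr0.
move=> /negPf r; move: rat; rewrite r /= => n_gt1.
(* By [N_diag] the commutator of diag(i) N^(n-2) with N is N^(n-1); the scalar is the coefficient n
   (b^2 + b) to be matched. The exponent n - 2 is where 1 < n enters. *)
pose D : 'M[k]_n := (n%:R * (eig c ^+ 2 + eig c)) *:
  (diag_mx (\row_(i < n) i%:R) *m N_ n ^+ n.-2).
apply: (lower D); rewrite BN; [exact: N_nilpotent|rewrite QN].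
rewrite /B Jordan_tr mulmxDr mulmxDl [D *m _%:M]scalar_mxC addrACA addmm // addr0.
rewrite /D -scalemxAl -scalemxAr -scalerDr scalerA; congr (_ *: _).
have NN : N_ n ^+ n.-2 *m N_ n = N_ n *m N_ n ^+ n.-2.
  by rewrite -[LHS]/(_ * N_ n) -[RHS]/(N_ n * _) -exprS -exprSr.
rewrite -mulmxA NN !mulmxA -mulmxDl N_diag -[RHS]/(N_ n * _) -exprS.
by congr (_ ^+ _); case: n n_gt1 {lower B BN QE n_gt0 QN D NN} => [|[]].
Qed.

(** The obstruction says that (J - b)^j = 0 for a Jordan block J of size m, which determines b and
    bounds the nilpotency index. *)
Lemma Vmod_killed_eig m c b j : (0 < m)%N ->
  killed (gen1 c) (gen2 c) b j (Vmod char2 m c) -> b = eig c /\ (m <= j)%N.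
Proof.
move=> m_gt0 /(killed_obstruction (Vmod_gen1 m c) (Vmod_gen2 m c)) [Z []].
rewrite mulmx1 => -> _; rewrite mul1mx Jordan_tr -addrA -raddfB /= => E.
have eb : b = eig c.
  apply/eqP; rewrite eq_sym -subr_eq0; apply/negPn/negP => nz.
  pose v : 'rV[k]_m := delta_mx 0 (Ordinal m_gt0).
  have vN : v *m N_ m = 0.
    by rewrite -rowE; apply/rowP=> i; rewrite mxE N_E mxE.
  have vE i : v *m (N_ m + (eig c - b)%:M) ^+ i = (eig c - b) ^+ i *: v.
    elim: i => [|i IH]; first by rewrite !expr0 mulmx1 scale1r.
    rewrite exprS -[_ * _]/(_ *m _) mulmxA mulmxDr vN add0r mul_mx_scalar.
    by rewrite -scalemxAl IH scalerA -exprS.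
  have := vE j; rewrite E mulmx0 => /rowP /(_ (Ordinal m_gt0)) /eqP.
  by rewrite !mxE !eqxx mulr1 eq_sym expf_eq0 (negPf nz) andbF.
split=> //; rewrite leqNgt; apply/negP => /N_exp_neq0 /eqP; apply.
by move: E; rewrite eb subrr raddf0 addr0.
Qed.

(** Separates finite points from oo: with the generators exchanged, the obstruction would make the
    inverse of an invertible Jordan block nilpotent. *)
Lemma Vmod_not_swap m c j : (0 < m)%N ->
  ~ killed (gen2 c) (gen1 c) 0 j (Vmod char2 m c).
Proof.
move=> m_gt0 /(killed_obstruction (Vmod_gen2 m c) (Vmod_gen1 m c)) [Z [ZX XZ]].
rewrite mulmx1 raddf0 subr0 => Zj.
set X := (Jordan _ _)^T in ZX XZ.
have : Z ^+ j *m X ^+ j = 1%:M.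
  elim: j {Zj} => [|j IH]; first by rewrite mulmx1.
  rewrite exprSr exprS -[_ * Z]/(_ *m Z) -[X * _]/(X *m _) mulmxA -(mulmxA _ Z) ZX.
  by rewrite mulmx1.
rewrite Zj mul0mx => /matrixP /(_ (Ordinal m_gt0) (Ordinal m_gt0)) /eqP.
by rewrite !mxE eqxx eq_sym oner_eq0.
Qed.

(** For m < n the exponent n works for V_m(c), so V_m(c) is a retract of V_n(c) (x) V_m(c). *)
Lemma Vmod_sub m n c : (0 < m <= n)%N ->
  ideal_of (Vmod char2 m c) `<=` ideal_of (Vmod char2 n c).
Proof.
move=> /andP[m_gt0]; rewrite leq_eqVlt => /predU1P[->//|mn].
case: n mn => // n mn; apply: sub_ideal_of; apply/ideal_ofP; exists (Vmod char2 m c).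
apply: (@killed_retract_V k char2 _ _ (gens12 c) (eig c) n _ (Vmod char2 n.+1 c)
  (Vmod_gen1 n.+1 c) (Vmod_gen2 n.+1 c)).
by apply: Vmod_killed; rewrite mn.
Qed.

Definition kill_exponent n c := if rational c || (1 < n)%N then n else n.+1.

Lemma kill_exponentP n c : (0 < n)%N ->
  killed (gen1 c) (gen2 c) (eig c) (kill_exponent n c) (Vmod char2 n c).
Proof.
move=> n0; apply: Vmod_killed; rewrite /kill_exponent.
by case: (boolP (rational c || (1 < n)%N)) => [|_]; rewrite ?ltnSn // n0 eqxx orbT.
Qed.

Lemma Vmod_sub_inv m n c c' : (0 < m)%N -> (0 < n)%N ->
  ideal_of (Vmod char2 m c) `<=` ideal_of (Vmod char2 n c') ->
  c = c' /\ (m <= kill_exponent n c)%N.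
Proof.
move=> m0 n0 /(_ _ (ideal_of_refl _)).
move=> /(killed_ideal_of char2 (gens12 c') (kill_exponentP c' n0)).
case: c c' => [a|] [a'|] kM.
- by have [e le_m] := Vmod_killed_eig m0 kM; rewrite /= in e; rewrite -e in le_m *.
- by case: (Vmod_not_swap (c := Some a) m0 kM).
(* V_m(oo) against a finite point: the matrix that would have to be invertible is a nilpotent Jordan
   block, whose transpose has first row 0. *)
- have := killed_obstruction (Vmod_gen2 m None) (Vmod_gen1 m None) kM.
  case=> Z [_ XZ _]; pose i0 := Ordinal m0.
  move/matrixP/(_ i0 i0)/eqP: XZ; rewrite !mxE eqxx big1 ?[0 == _]eq_sym ?oner_eq0 // => i _.
  by rewrite (N_E i0) mul0r.
by have [_ le_m] := Vmod_killed_eig m0 kM.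
Qed.

End VModuleIdeals.

(** * Containments between the ideals of the V_n *)

Section VModuleContainments.
Variable k : fieldType.
Hypothesis char2 : 2%N \in [pchar k].
Implicit Types M N L P W : kV4mod k.

Lemma sum_V4 (T : nmodType) (F : 'Z_2 * 'Z_2 -> T) :
  \sum_z F z = F 1%g + F g4 + (F h4 + F (g4 * h4)%g).
Proof.
have e2 (u v : 'Z_2) : u = v :> nat -> u = v by apply: val_inj.
have -> : \sum_z F z = \sum_z F (z.1, z.2) by apply: eq_bigr => -[].
rewrite -(pair_bigA _ (fun a b => F (a, b))) /= !big_ord_recl !big_ord0 /= !addr0.
rewrite addrACA; congr (_ + _ + (_ + _)); congr F;
  by apply: injective_projections; apply: val_inj.
Qed.

(** Transitivity of the transfer: summing E over the second generator first gives e, summing it over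
    the first generator gives d. *)
Lemma higman_killed (c : option k) b P : higman P -> killed (gen1 c) (gen2 c) b 0 P.
Proof.
move=> [E]; rewrite sum_V4 !repr_mx1 mul1mx mulmx1 => trE.
have idT z w : (z, w) = (g4, h4) \/ (z, w) = (h4, g4) ->
    E + P z *m E *m P z + (P w *m (E + P z *m E *m P z) *m P w) = 1%:M.
  move=> gzw; rewrite mulmxDr mulmxDl.
  have -> : P w *m (P z *m E *m P z) *m P w = P (z * w)%g *m E *m P (z * w)%g.
    by rewrite {1}V4_comm !repr_mxM // !mulmxA.
  case: gzw => -[-> ->]; first exact: trE.
  by rewrite addrACA V4_comm.
exists (E + P (gen2 c) *m E *m P (gen2 c)); split.
  by apply: idT; case: c; [right|left].
exists (E + P (gen1 c) *m E *m P (gen1 c)); split.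
  by rewrite mulmxDr mulmxDl !mulmxA kV4_sqr mul1mx -!mulmxA kV4_sqr mulmx1 addrC.
by rewrite expr0 -[LHS](idT (gen1 c) (gen2 c)) //; case: c; [left|right].
Qed.

Lemma Vmod_not_projective n c : (0 < n)%N -> ~ projective (Vmod char2 n c).
Proof.
move=> n0 /projectiveP /(higman_killed c (eig c)).
by case/(Vmod_killed_eig n0) => _; rewrite leqNgt n0.
Qed.

Lemma Proj_ltV n c : (0 < n)%N -> Proj k `<` ideal_of (Vmod char2 n c).
Proof.
move=> n0; split.
  apply: Proj_sub_ideal; first exact: ideal_of_ideal.
  by exists (Vmod char2 n c); [exact: ideal_of_refl|rewrite /nonzero /= addn_gt0 n0].
by move=> /(_ _ (ideal_of_refl _)); apply: Vmod_not_projective.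
Qed.

Lemma trivial_notin_V n c : (0 < n)%N -> ~ ideal_of (Vmod char2 n c) (trivial_mod k).
Proof.
move=> n0 /(killed_ideal_of char2 (gens12 c) (kill_exponentP char2 c n0)).
by move=> /(killed_even char2) /eqP; rewrite oner_eq0.
Qed.

Lemma V_lt_trivial n c : (0 < n)%N ->
  ideal_of (Vmod char2 n c) `<` ideal_of (trivial_mod k).
Proof.
move=> n0; rewrite ideal_of_trivial; split=> // /(_ (trivial_mod k) I).
exact: trivial_notin_V.
Qed.

Lemma Vmod_lt m n c : (0 < m < n)%N -> rational c || ((m, n) != (1%N, 2%N)) ->
  ideal_of (Vmod char2 m c) `<` ideal_of (Vmod char2 n c).
Proof.
move=> /andP[m0 mn] rat; have n0 := ltn_trans m0 mn.
split; first by apply: Vmod_sub; rewrite m0 ltnW.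
case/Vmod_sub_inv => // _; rewrite /kill_exponent; case: ifP => [_|]; first by rewrite leqNgt mn.
move/negbT; rewrite negb_or -leqNgt => /andP[/negPf r m1].
move: rat mn; rewrite r; case: m m0 m1 => [|[|]] // _ _.
by case: n n0 => [|[|[|n]]].
Qed.

Definition rows m n (s : seq (seq k)) : 'M[k]_(m, n) :=
  \matrix_(i, j) (nth [::] s i)`_j.

(* In terms of a basis a, b of V_1(a) with x a = b and y a = c b, and with
   s = c^2 + c, the basis f_0, f_1, e_0, e_1 of V_2(c) is mapped to
   s (b (x) b), a (x) b + b (x) a + b (x) b, s (a (x) b), a (x) a. *)
Lemma V2_retract (a : k) : a != 0 -> a != 1 ->
  retract (Vmod char2 2 (Some a)) (tensor (Vmod char2 1 (Some a)) (Vmod char2 1 (Some a))).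
Proof.
(* For u spanning the top of V_1(a) and w = x u, the coproduct gives (y - a x)(u (x) u) = (a^2 + a)
   w (x) w, which is f_0 if e_1 = u (x) u. This is the origin of s, and s is nonzero exactly off
   F_2. *)
move=> a0 a1; pose s := a ^+ 2 + a.
have s0 : s != 0.
  by rewrite /s expr2 -{3}[a]mulr1 -mulrDr mulf_neq0 // addr_eq0 -[- 1]mulr1 (oppr_pchar2 char2) ?mulr1.
pose Q (j : 'I_(1 + 1)) : 'M[k]_(2 + 2, 1 + 1) :=
  if val j == 0%N then rows _ _ [:: [:: s; 0]; [:: 1; 1]; [:: 0; 0]; [:: 0; 0]]
  else rows _ _ [:: [:: 0; 0]; [:: 1; 0]; [:: s; 0]; [:: 0; 1]].
pose P (j : 'I_(1 + 1)) : 'M[k]_(1 + 1, 2 + 2) :=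
  if val j == 0%N then rows _ _ [:: [:: s^-1; 0; 0; 0]; [:: s^-1; 1; s^-1; 0]]
  else rows _ _ [:: [:: 0; 0; s^-1; 0]; [:: 0; 0; 0; 1]].
have QP : cofam Q *m fam P = 1%:M.
  rewrite cofam_fam; apply/matrixP => i j.
  rewrite summxE !big_ord_recl big_ord0 /Q /P /= !mxE !big_ord_recl !big_ord0 !mxE /=.
  have ss : s^-1 + s^-1 = 0 by rewrite -mulr2n (mulrn_pchar char2).
  by case: i j => [[|[|[|[|i]]]] hi] [[|[|[|[|j]]]] hj] //=;
    rewrite ?(mulr0, mul0r, addr0, add0r, mulr1, mul1r, mulfV s0, ss).
have PQ : fam P *m cofam Q = 1%:M by apply: mulmx1C; exact: QP.
have V1g : Vmod char2 1 (Some a) g4 = rows 2 2 [:: [:: 1; 0]; [:: 1; 1]].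
  apply: etrans (Vmod_gen1 char2 1 (Some a)) _; by apply/matrixP=> i j;
    case: (split_ordP i) => {}i ->; case: (split_ordP j) => {}j ->;
    rewrite ?(block_mxEul, block_mxEur, block_mxEdl, block_mxEdr) !mxE;
    case: i j => [[|[|?]] ?] [[|[|?]] ?] //=.
have V1h : Vmod char2 1 (Some a) h4 = rows 2 2 [:: [:: 1; 0]; [:: a; 1]].
  apply: etrans (Vmod_gen2 char2 1 (Some a)) _; by apply/matrixP=> i j;
    case: (split_ordP i) => {}i ->; case: (split_ordP j) => {}j ->;
    rewrite ?(block_mxEul, block_mxEur, block_mxEdl, block_mxEdr) !mxE;
    case: i j => [[|[|?]] ?] [[|[|?]] ?] //=.
have V2g : Vmod char2 2 (Some a) g4 = rows 4 4
    [:: [:: 1; 0; 0; 0]; [:: 0; 1; 0; 0]; [:: 1; 0; 1; 0]; [:: 0; 1; 0; 1]].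
  apply: etrans (Vmod_gen1 char2 2 (Some a)) _; by apply/matrixP=> i j;
    case: (split_ordP i) => {}i ->; case: (split_ordP j) => {}j ->;
    rewrite ?(block_mxEul, block_mxEur, block_mxEdl, block_mxEdr) !mxE;
    case: i j => [[|[|?]] ?] [[|[|?]] ?] //=.
have V2h : Vmod char2 2 (Some a) h4 = rows 4 4
    [:: [:: 1; 0; 0; 0]; [:: 0; 1; 0; 0]; [:: a; 0; 1; 0]; [:: 1; a; 0; 1]].
  apply: etrans (Vmod_gen2 char2 2 (Some a)) _; by apply/matrixP=> i j;
    case: (split_ordP i) => {}i ->; case: (split_ordP j) => {}j ->;
    rewrite ?(block_mxEul, block_mxEur, block_mxEdl, block_mxEdr) !mxE;
    case: i j => [[|[|?]] ?] [[|[|?]] ?] //=.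
have hQ : @is_hom k (Vmod char2 2 (Some a)) (tensor (Vmod char2 1 (Some a)) (Vmod char2 1 (Some a))) (cofam Q).
  apply: (gen_hom generators_gh); rewrite cofam_tprod mul_cofam; apply: eq_cofam => j.
    rewrite V1g V2g; apply/matrixP=> i l; rewrite summxE /Q.
    rewrite !big_ord_recl big_ord0 !mxE !big_ord_recl !big_ord0 !mxE /=.
    case: j i l => [[|[|j]] hj] [[|[|[|[|i]]]] hi] [[|[|l]] hl] //=;
      rewrite !mxE /= ?(mulr0, mul0r, addr0, add0r, mulr1, mul1r) //.
    by rewrite -addrA -mulr2n (mulrn_pchar char2) addr0.
  rewrite V1h V2h; apply/matrixP=> i l; rewrite summxE /Q.
  rewrite !big_ord_recl big_ord0 !mxE !big_ord_recl !big_ord0 !mxE /=.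
  case: j i l => [[|[|j]] hj] [[|[|[|[|i]]]] hi] [[|[|l]] hl] //=;
    rewrite !mxE /= ?(mulr0, mul0r, addr0, add0r, mulr1, mul1r) //.
    by rewrite -addrA -mulr2n (mulrn_pchar char2) addr0.
  by rewrite /s -addrA -mulr2n (mulrn_pchar char2) addr0 expr2.
exists (cofam Q), (fam P); split=> // z z4.
rewrite -[LHS]mul1mx -PQ -mulmxA (mulmxA (cofam Q)) -hQ //.
by rewrite -!mulmxA QP mulmx1.
Qed.

Lemma V2_eq_V1 (a : k) : a != 0 -> a != 1 ->
  ideal_of (Vmod char2 2 (Some a)) = ideal_of (Vmod char2 1 (Some a)).
Proof.
move=> a0 a1; apply/seteqP; split; last exact: Vmod_sub.
apply: sub_ideal_of; apply/ideal_ofP; exists (Vmod char2 1 (Some a)); exact: V2_retract.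
Qed.

End VModuleContainments.

(** * Kronecker modules and their Heller shifts *)

Section Kronecker.
Variable k : fieldType.
Hypothesis char2 : 2%N \in [pchar k].
Implicit Types M N L P W : kV4mod k.

Definition lowmx a b (X : 'M[k]_(a, b)) : 'M_(b + a) := block_mx 1%:M 0 X 1%:M.

Lemma lowmxM a b (X Y : 'M[k]_(a, b)) : lowmx X *m lowmx Y = lowmx (X + Y).
Proof.
by rewrite mulmx_block !(mul0mx, mulmx0, mul1mx, mulmx1, add0r, addr0).
Qed.

Lemma lowmx0 a b : lowmx (0 : 'M[k]_(a, b)) = 1%:M.
Proof. by rewrite scalar_mx_block. Qed.

Lemma lowmx_sqr a b (X : 'M[k]_(a, b)) : lowmx X *m lowmx X = 1%:M.
Proof. by rewrite lowmxM addmm // lowmx0. Qed.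

Lemma lowmx_comm a b (X Y : 'M[k]_(a, b)) : lowmx X *m lowmx Y = lowmx Y *m lowmx X.
Proof. by rewrite !lowmxM addrC. Qed.

(* The module of radical square zero attached to a Kronecker module: X and Y
   are the actions of x and y from the top k^a to the socle k^b. *)
Definition kron_mod a b (X Y : 'M[k]_(a, b)) : kV4mod k :=
  klein_mod (lowmx_sqr X) (lowmx_sqr Y) (lowmx_comm X Y).

Lemma kron_modg a b (X Y : 'M[k]_(a, b)) : kron_mod X Y g4 = lowmx X.
Proof. exact: klein_modg. Qed.

Lemma kron_modh a b (X Y : 'M[k]_(a, b)) : kron_mod X Y h4 = lowmx Y.
Proof. exact: klein_modh. Qed.

Section Free.
Variable b : nat.

Definition free_g : 'M[k]_((b + b) + (b + b)) := lowmx 1%:M.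
Definition free_h : 'M[k]_((b + b) + (b + b)) :=
  block_mx (lowmx 1%:M) 0 0 (lowmx 1%:M).

Lemma free_gg : free_g *m free_g = 1%:M. Proof. exact: lowmx_sqr. Qed.

Lemma free_hh : free_h *m free_h = 1%:M.
Proof.
rewrite mulmx_block !(mul0mx, mulmx0, add0r, addr0) !lowmx_sqr.
by rewrite -scalar_mx_block.
Qed.

Lemma free_gh : free_g *m free_h = free_h *m free_g.
Proof.
by rewrite !mulmx_block !(mul0mx, mulmx0, mul1mx, mulmx1, add0r, addr0).
Qed.

(* The free module kV_4^b; the four blocks of coordinates belong to xy, x, y
   and 1, in this order. *)
Definition free_mod : kV4mod k := klein_mod free_gg free_hh free_gh.

Lemma free_modg : free_mod g4 = free_g. Proof. exact: klein_modg. Qed.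
Lemma free_modh : free_mod h4 = free_h. Proof. exact: klein_modh. Qed.

Lemma higman_free : higman free_mod.
Proof.
(* [e] has transfer 1 under one generator. Nesting it in itself gives E, whose transfer is computed
   along h and then along g. *)
pose e n : 'M[k]_(n + n) := block_mx 0 1%:M 0 1%:M.
have eE n : e n + lowmx 1%:M *m e n *m lowmx 1%:M = 1%:M.
  rewrite /e /lowmx !mulmx_block !(mul0mx, mulmx0, mul1mx, mulmx1, add0r, addr0).
  by rewrite !add_block_mx !(add0r, addr0) !addmm // addr0 -scalar_mx_block.
exists (block_mx 0 (e b) 0 (e b)); rewrite sum_V4 repr_mx1 mul1mx mulmx1.
set E := block_mx _ _ _ _.
have hE : E + free_mod h4 *m E *m free_mod h4 = e (b + b)%N.
  rewrite free_modh /E /free_h; move: (e b) (lowmx _) (eE b) => e' H HE.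
  rewrite !mulmx_block !(mul0mx, mulmx0, add0r, addr0).
  by rewrite add_block_mx HE addr0.
have -> : free_mod (g4 * h4)%g *m E *m free_mod (g4 * h4)%g =
    free_mod g4 *m (free_mod h4 *m E *m free_mod h4) *m free_mod g4.
  by rewrite {2}V4_comm !repr_mxM // !mulmxA.
by rewrite addrACA hE -mulmxDl -mulmxDr hE free_modg; apply: eE.
Qed.

Lemma mul_free_g m (u1 u2 u3 u4 : 'M[k]_(m, b)) :
  row_mx (row_mx u1 u2) (row_mx u3 u4) *m (free_g + 1%:M) =
  row_mx (row_mx u3 u4) 0.
Proof.
rewrite mulmxDr mulmx1 mul_row_block !(mulmx0, mulmx1, add0r, addr0).
by rewrite add_row_mx addrAC addmm // add0r addmm.
Qed.

Lemma mul_free_h m (u1 u2 u3 u4 : 'M[k]_(m, b)) :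
  row_mx (row_mx u1 u2) (row_mx u3 u4) *m (free_h + 1%:M) =
  row_mx (row_mx u2 0) (row_mx u4 0).
Proof.
rewrite mulmxDr mulmx1 mul_row_block !(mulmx0, add0r, addr0).
rewrite !mul_row_block !(mulmx0, mulmx1, add0r, addr0) !add_row_mx.
by rewrite (addrAC u1) (addrAC u3) !addmm // !add0r.
Qed.

End Free.

(** An exact sequence 0 -> k^a -> k^b + k^b -> k^c -> 0, with exactness in the middle replaced by
    the dimension count. Y comes first in the row because a top vector v goes to x (v Y) + y (v X)
    in the free module: multiplying this by x must leave xy (v X). *)
Definition exact_kron a b c (X Y : 'M[k]_(a, b)) (X' Y' : 'M[k]_(b, c)) :=
  [/\ row_free (row_mx Y X), row_full (col_mx X' Y'),
      row_mx Y X *m col_mx X' Y' = 0 & (a + c = b + b)%N].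

Section Exact.
Variables (a b c : nat) (X Y : 'M[k]_(a, b)) (X' Y' : 'M[k]_(b, c)).
Hypothesis exXY : exact_kron X Y X' Y'.
Let M := kron_mod X Y.
Let N := kron_mod X' Y'.
Let P := free_mod b.

Definition kron_inj : 'M[k]_(b + a, (b + b) + (b + b)) :=
  block_mx (row_mx 1%:M 0) 0 (row_mx 0 Y) (row_mx X 0).
Definition kron_proj : 'M[k]_((b + b) + (b + b), c + b) :=
  block_mx (col_mx 0 X') 0 (col_mx Y' 0) (col_mx 0 1%:M).

Let hom_nilp L1 L2 (f : 'M[k]_(rdegree L1, rdegree L2)) z :
  L1 z *m f = f *m L2 z <-> (L1 z + 1%:M) *m f = f *m (L2 z + 1%:M).
Proof.
rewrite mulmxDl mulmxDr mul1mx mulmx1.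
by split=> [->//|/addIr].
Qed.

Let lowmxD1 a1 b1 (Z : 'M[k]_(a1, b1)) : lowmx Z + 1%:M = block_mx 0 0 Z 0.
Proof. by rewrite scalar_mx_block add_block_mx !addmm // !addr0. Qed.

Let free_h1 : free_mod b h4 + 1%:M =
  block_mx (block_mx 0 0 1%:M 0) 0 0 (block_mx 0 0 1%:M 0).
Proof. by rewrite free_modh scalar_mx_block add_block_mx !lowmxD1 !addr0. Qed.

Lemma kron_inj_hom : @is_hom k M P kron_inj.
Proof.
apply: (gen_hom generators_gh); apply/hom_nilp.
  rewrite kron_modg free_modg !lowmxD1 /kron_inj !mulmx_block.
  by rewrite !(mul0mx, mulmx0, mulmx1, addr0, add0r) mul_mx_row mulmx1 mulmx0.
rewrite kron_modh lowmxD1 free_h1 /kron_inj !mulmx_block.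
rewrite !(mul0mx, mulmx0, add0r, addr0) !mul_row_block !mul_mx_row.
by rewrite !(mul0mx, mulmx0, mulmx1, add0r, addr0) !row_mx0.
Qed.

Lemma kron_proj_hom : @is_hom k P N kron_proj.
Proof.
apply: (gen_hom generators_gh); apply/hom_nilp.
  rewrite kron_modg free_modg !lowmxD1 /kron_proj !mulmx_block.
  by rewrite !(mul0mx, mulmx0, mul1mx, add0r, addr0) !mul_col_mx !(mul0mx, mul1mx).
rewrite kron_modh lowmxD1 free_h1 /kron_proj !mulmx_block.
rewrite !(mul0mx, mulmx0, add0r, addr0) !mul_block_col !mul_col_mx.
by rewrite !(mul0mx, mulmx0, mul1mx, add0r, addr0) !col_mx0.
Qed.

Lemma kron_short_exact : @short_exact k M P N kron_inj kron_proj.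
Proof.
have [freeXY fullXY XY0 abc] := exXY.
have free_i : row_free kron_inj.
  have /row_freeP[B] := freeXY; rewrite -[B]vsubmxK mul_row_col => YX.
  apply/row_freeP.
  exists (block_mx (col_mx 1%:M 0) (col_mx 0 (usubmx B)) 0 (col_mx (dsubmx B) 0)).
  rewrite mulmx_block !mul_row_col !(mul0mx, mulmx0, mul1mx, add0r, addr0).
  by rewrite YX -scalar_mx_block.
have full_p : row_full kron_proj.
  have /row_fullP[B] := fullXY; rewrite -[B]hsubmxK mul_row_col => YX.
  apply/row_fullP.
  exists (block_mx (row_mx 0 (lsubmx B)) (row_mx (rsubmx B) 0) 0 (row_mx 0 1%:M)).
  rewrite mulmx_block !mul_row_col !(mul0mx, mulmx0, mul1mx, add0r, addr0).
  by rewrite YX -scalar_mx_block.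
split; [exact: kron_inj_hom|exact: kron_proj_hom|exact: free_i|exact: full_p|].
have ip0 : kron_inj *m kron_proj = 0.
  rewrite mulmx_block !mul_row_col !(mul0mx, mulmx0, mul1mx, add0r, addr0).
  by move: XY0; rewrite mul_row_col => ->; rewrite block_mx0.
have sub_i : (kron_inj <= kermx kron_proj)%MS by apply/sub_kermxP.
have [_ <-] := mxrank_leqif_eq sub_i.
rewrite mxrank_ker (eqP free_i) (eqP full_p).
apply/eqP; rewrite -[LHS](addnK (c + b)%N) addnACA.
by rewrite [(b + c)%N]addnC [X in (X - _)%N]addnC addnACA abc.
Qed.

Let vec m (u1 u2 u3 u4 : 'M[k]_(m, b)) := row_mx (row_mx u1 u2) (row_mx u3 u4).

Let vecE m (v : 'M[k]_(m, (b + b) + (b + b))) :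
  exists u1 u2 u3 u4, v = vec u1 u2 u3 u4.
Proof.
exists (lsubmx (lsubmx v)), (rsubmx (lsubmx v)), (lsubmx (rsubmx v)), (rsubmx (rsubmx v)).
by rewrite /vec !hsubmxK.
Qed.

Let vec_x m (u1 u2 u3 u4 : 'M[k]_(m, b)) :
  vec u1 u2 u3 u4 *m (free_mod b g4 + 1%:M) = vec u3 u4 0 0.
Proof. by rewrite free_modg mul_free_g /vec row_mx0. Qed.

Let vec_y m (u1 u2 u3 u4 : 'M[k]_(m, b)) :
  vec u1 u2 u3 u4 *m (free_mod b h4 + 1%:M) = vec u2 0 u4 0.
Proof. by rewrite free_modh mul_free_h. Qed.

Let mul_vec m (v : 'M[k]_m) (u1 u2 u3 u4 : 'M[k]_(m, b)) :
  v *m vec u1 u2 u3 u4 = vec (v *m u1) (v *m u2) (v *m u3) (v *m u4).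
Proof. by rewrite /vec !mul_mx_row. Qed.

(** Nakayama's lemma by hand: the generators lift to S with S f = 1 + (radical terms). Multiplying
    by x, y and xy gives a unitriangular system, which is solved from the xy coordinate upwards. *)
Lemma kron_projective_cover : @projective_cover k P N kron_proj.
Proof.
have [hi hp _ full_p _] := kron_short_exact.
split=> //; first by apply: higman_projective; exact: higman_free.
move=> L f hf /row_fullP[Q Qfp]; rewrite /= in f hf Qfp *.
pose S : 'M_(b, rdegree L) := (row_mx 0 1%:M : 'M_(b, c + b)) *m Q.
have [r1 [r2 [r3 [r4 Sf]]]] := vecE (S *m f).
have r41 : r4 = 1%:M.
  have : S *m f *m kron_proj = row_mx 0 1%:M by rewrite -mulmxA /S -mulmxA Qfp mulmx1.
  rewrite Sf /vec /kron_proj mul_row_block !mul_row_col !(mulmx0, add0r, mulmx1).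
  by case/eq_row_mx.
have sub_f z (s : 'M_(b, rdegree L)) : exists s' : 'M_(b, rdegree L),
    s' *m f = s *m f *m (P z + 1%:M).
  exists (s *m (L z + 1%:M)); rewrite -!mulmxA; congr (_ *m _).
  exact: (iffLR (@hom_nilp L P f z) (hf z (in_V4 z))).
clearbody S; rewrite r41 in Sf; have [Sx] := sub_f g4 S; rewrite Sf vec_x => Sxf.
have [Sy] := sub_f h4 S; rewrite Sf vec_y => Syf.
have [Sxy] := sub_f h4 Sx; rewrite Sxf vec_y => Sxyf.
have vecB m (u1 u2 u3 u4 w1 w2 w3 w4 : 'M[k]_(m, b)) :
    vec u1 u2 u3 u4 - vec w1 w2 w3 w4 = vec (u1 - w1) (u2 - w2) (u3 - w3) (u4 - w4).
  by rewrite /vec !opp_row_mx !add_row_mx.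
pose Tx := Sx - r3 *m Sxy; pose Ty := Sy - r2 *m Sxy.
have Txf : Tx *m f = vec 0 1%:M 0 0.
  by rewrite mulmxBl -mulmxA Sxf Sxyf mul_vec vecB !mulmx0 mulmx1 subrr !subr0.
have Tyf : Ty *m f = vec 0 0 1%:M 0.
  by rewrite mulmxBl -mulmxA Syf Sxyf mul_vec vecB !mulmx0 mulmx1 subrr !subr0.
clearbody Tx Ty; pose T1 := S - r1 *m Sxy - r2 *m Tx - r3 *m Ty.
have T1f : T1 *m f = vec 0 0 0 1%:M.
  rewrite !mulmxBl -!mulmxA Sf Sxyf Txf Tyf !mul_vec !vecB !mulmx0 !mulmx1.
  by rewrite !subr0 !subrr.
apply/row_fullP; exists (col_mx (col_mx Sxy Tx) (col_mx Ty T1)).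
rewrite !mul_col_mx Sxyf Txf Tyf T1f /vec.
rewrite [RHS](scalar_mx_block (b + b) (b + b)) (scalar_mx_block b b) [RHS]block_mxEv.
by congr col_mx; rewrite -[LHS]block_mxEv [LHS]block_mxEh !row_mx0 col_mx0 block_mxEv.
Qed.

(** The kernel of f is stable under x and y, which move the last nonzero coordinate of a vector into
    the socle xy k^b; this socle lies in the image of the injection, where f is injective. *)
Lemma kron_injective_hull : @injective_hull k M P kron_inj.
Proof.
have [hi hp free_i _ _] := kron_short_exact.
split=> //; first by apply: higman_injective; exact: higman_free.
move=> L f hf /row_freeP[Q ifQ]; rewrite /= in f hf ifQ *.
have inj1 m (v1 : 'M_(m, b)) : vec v1 0 0 0 *m f = 0 -> v1 = 0.
  move=> vf; have : row_mx v1 0 *m (kron_inj *m f *m Q) = 0.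
    rewrite !mulmxA mul_row_block !mul_mx_row !(mul0mx, mulmx0, mulmx1, addr0) row_mx0 !addr0.
    by move: vf; rewrite /vec row_mx0 => ->; rewrite mul0mx.
  by rewrite ifQ mulmx1 -[X in _ = X](@row_mx0 _ m b a) => /eq_row_mx[].
have hx z m (v : 'M_(m, (b + b) + (b + b))) : v *m f = 0 -> v *m (P z + 1%:M) *m f = 0.
  move=> vf; rewrite -mulmxA; have -> : (P z + 1%:M) *m f = f *m (L z + 1%:M).
    by exact: (iffLR (@hom_nilp P L f z) (hf z (in_V4 z))).
  by rewrite mulmxA vf mul0mx.
rewrite -kermx_eq0; apply/eqP; have := mulmx_ker f.
have [v1 [v2 [v3 [v4 ->]]]] := vecE (kermx f) => vf.
have v40 : v4 = 0.
  by apply: inj1; have := hx h4 _ _ (hx g4 _ _ vf); rewrite vec_x vec_y.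
rewrite v40 in vf *.
have v30 : v3 = 0 by apply: inj1; have := hx g4 _ _ vf; rewrite vec_x.
rewrite v30 in vf *.
have v20 : v2 = 0 by apply: inj1; have := hx h4 _ _ vf; rewrite vec_y.
rewrite v20 in vf *.
by rewrite (inj1 _ _ vf) /vec !row_mx0.
Qed.

Lemma kron_syzygy : syzygy N M.
Proof.
exists P, kron_inj, kron_proj; split.
  exact: kron_projective_cover.
exact: kron_short_exact.
Qed.

Lemma kron_cosyzygy : cosyzygy M N.
Proof.
exists P, kron_inj, kron_proj; split.
  exact: kron_injective_hull.
exact: kron_short_exact.
Qed.

End Exact.
End Kronecker.

(** * The Heller shifts of the trivial module *)

Section Heller.
Variable k : fieldType.
Hypothesis char2 : 2%N \in [pchar k].
Implicit Types M N L P W : kV4mod k.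

Lemma row_full_mulr m n p (A : 'M[k]_(m, n)) (B : 'M_(n, p)) (C : 'M_(p, n)) :
  B *m C = 1%:M -> C *m B = 1%:M -> row_full (A *m B) -> row_full A.
Proof.
move=> BC CB /row_fullP[D DAB]; apply/row_fullP; exists (B *m D).
have -> : B *m D *m A = B *m (D *m (A *m B)) *m C.
  by rewrite !mulmxA -(mulmxA _ B C) BC mulmx1.
by rewrite DAB mulmx1.
Qed.

Lemma syzygy_iso M M' N : iso M M' -> syzygy M N -> syzygy M' N.
Proof.
case/isoP=> j [r [hj hr jr rj]] [P [i [p [[prP hp full_p ess] [hi _ free_i _ exact_ip]]]]].
have full_pj : row_full (p *m j).
  have /row_fullP[B BA] := full_p; apply/row_fullP; exists (r *m B).
  by rewrite -mulmxA (mulmxA B) BA mul1mx.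
have hpj : is_hom (p *m j) by apply: is_hom_mul.
exists P, i, (p *m j); split; split=> //.
  move=> L f hf; rewrite mulmxA => full_fpj; apply: ess => //.
  exact: row_full_mulr jr rj full_fpj.
have kpj : (kermx p :=: kermx (p *m j))%MS.
  apply/eqmxP/andP; split; apply/sub_kermxP.
    by rewrite mulmxA mulmx_ker mul0mx.
  have : kermx (p *m j) *m (p *m j) *m r = 0 by rewrite mulmx_ker mul0mx.
  by rewrite -[in X in X -> _]mulmxA -(mulmxA p) jr mulmx1.
by apply/eqmxP; apply: eqmx_trans kpj; apply/eqmxP.
Qed.

Lemma cosyzygy_iso M M' N : iso M M' -> cosyzygy M N -> cosyzygy M' N.
Proof.
case/isoP=> j [r [hj hr jr rj]] [P [i [p [[inP hi free_i ess] [_ hp _ full_p exact_ip]]]]].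
have free_ri : row_free (r *m i).
  have /row_freeP[B iB] := free_i; apply/row_freeP; exists (B *m j).
  by rewrite -mulmxA (mulmxA i) iB mul1mx.
have hri : is_hom (r *m i) by apply: is_hom_mul.
exists P, (r *m i), p; split; split=> //.
  move=> L f hf /row_freeP[B rB]; apply: ess => //; apply/row_freeP; exists (B *m r).
  have -> : i *m f *m (B *m r) = j *m (r *m i *m f *m B) *m r.
    by rewrite !mulmxA jr mul1mx.
  by rewrite rB mulmx1.
have eri : (r *m i :=: i)%MS.
  apply/eqmxP; rewrite submxMl /=.
  by rewrite -{1}[i]mul1mx -jr -mulmxA submxMl.
by apply/eqmxP; apply: eqmx_trans eri _; apply/eqmxP.
Qed.

Section IterRel.
Variable R : kV4mod k -> kV4mod k -> Prop.

(** [iter_rel] unfolds at its first step while the inductions below add a last one; the isomorphism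
    ending the chain then has to be moved through R. *)
Lemma iter_rel_snoc n M L N :
  (forall M M' N, iso M M' -> R M N -> R M' N) ->
  iter_rel R n M L -> R L N -> iter_rel R n.+1 M N.
Proof.
move=> R_iso; elim: n M => [|n IH] M /=.
  move=> ML LN; exists N; last exact: mx_rsim_refl.
  by apply: R_iso LN; apply: iso_sym.
by move=> [L' ML' L'L] LN; exists L' => //; apply: IH LN.
Qed.

Lemma iter_rel_iso n M L N : iter_rel R n M L -> iso L N -> iter_rel R n M N.
Proof.
elim: n M => [|n IH] M /=; first exact: iso_trans.
by move=> [L' ML' L'L] LN; exists L' => //; apply: IH LN.
Qed.

Lemma iter_rel_degree n M N :
  (forall M N, R M N -> (rdegree N)%:R = (rdegree M)%:R :> k) ->
  iter_rel R n M N -> (rdegree N)%:R = (rdegree M)%:R :> k.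
Proof.
move=> Rdeg; elim: n M => [|n IH] M /=; first by move/mxrank_rsim ->.
by move=> [L ML LN]; rewrite (IH L LN) (Rdeg _ _ ML).
Qed.

End IterRel.

Lemma heller_iso n M L N : heller n M L -> iso L N -> heller n M N.
Proof. by case: n => n; apply: iter_rel_iso. Qed.

Lemma short_exact_degree L M N i p :
  @short_exact k L M N i p -> higman M -> (rdegree L)%:R = (rdegree N)%:R :> k.
Proof.
move=> [_ _ /eqP free_i /eqP full_p /eqmxP exact_ip] /(higman_even char2).
have <- : (rdegree N + rdegree L)%N = rdegree M.
  by rewrite -full_p -free_i exact_ip mxrank_ker subnKC // rank_leq_row.
move/eqP; rewrite natrD addrC addr_eq0 => /eqP ->.
by rewrite (oppr_pchar2 char2).
Qed.

Lemma heller_degree n M : heller n (trivial_mod k) M -> (rdegree M)%:R = 1 :> k.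
Proof.
have syz N L : syzygy N L -> (rdegree L)%:R = (rdegree N)%:R :> k.
  move=> [P [i [p [[/projectiveP hP _ _ _] ex]]]].
  exact: short_exact_degree ex hP.
have cosyz N L : cosyzygy N L -> (rdegree L)%:R = (rdegree N)%:R :> k.
  move=> [P [i [p [[/injective_moduleP hP _ _ _] ex]]]].
  by rewrite (short_exact_degree ex hP).
by case: n => n H; [rewrite (iter_rel_degree syz H)|rewrite (iter_rel_degree cosyz H)].
Qed.

Lemma heller_ideal_of n M : heller n (trivial_mod k) M -> ideal_of M = setT.
Proof.
by move=> /heller_degree deg; apply: oddmx_ideal_of => //; rewrite deg oner_neq0.
Qed.

Lemma trivial_iso M : rdegree M = 1%N -> M g4 = 1%:M -> M h4 = 1%:M ->
  iso (trivial_mod k) M.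
Proof.
case: M => n r /= n1; subst n => rg rh; exists 1%:M => //.
  by rewrite row_free_unit unitmx1.
have h1 : @is_hom k (trivial_mod k) (Representation r) 1%:M.
  by apply: (gen_hom generators_gh); rewrite /= (rg, rh).
exact: h1.
Qed.

(** Vector space duality, which turns statements on syzygies into statements on cosyzygies; X and Y
    trade places to keep the row convention of [exact_kron]. *)
Lemma exact_kron_tr a b c (X Y : 'M[k]_(a, b)) (X' Y' : 'M[k]_(b, c)) :
  exact_kron X Y X' Y' -> exact_kron Y'^T X'^T Y^T X^T.
Proof.
move=> [freeXY fullXY XY0 abc]; split; last by rewrite addnC.
- by rewrite -tr_col_mx /row_free mxrank_tr.
- by rewrite -tr_row_mx /row_full mxrank_tr.
by rewrite -tr_col_mx -tr_row_mx -trmx_mul XY0 trmx0.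
Qed.

(** Omega^n(k) as a zigzag: top vectors e_0, ..., e_n and socle vectors f_0, ..., f_(n-1), with x
    e_i = f_i and y e_i = f_(i-1), out of range vectors being 0. *)
Definition Xs n : 'M[k]_(n.+1, n) := \matrix_(i, j) (i == j :> nat)%:R.
Definition Ys n : 'M[k]_(n.+1, n) := \matrix_(i, j) (i == j.+1 :> nat)%:R.

Lemma mul_Xs m n (A : 'M[k]_(m, n.+1)) r (j : 'I_n) :
  (A *m Xs n) r j = A r (widen_ord (leqnSn _) j).
Proof.
rewrite mxE (bigD1 (widen_ord (leqnSn _) j)) //= big1 => [|i /negPf ij].
  by rewrite !mxE eqxx mulr1 addr0.
by rewrite mxE; have -> : (i == j :> nat) = false by []; rewrite mulr0.
Qed.

Lemma mul_Ys m n (A : 'M[k]_(m, n.+1)) r (j : 'I_n) :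
  (A *m Ys n) r j = A r (lift ord0 j).
Proof.
rewrite mxE (bigD1 (lift ord0 j)) //= big1 => [|i /negPf ij].
  by rewrite !mxE /= eqxx mulr1 addr0.
by rewrite mxE; have -> : (i == j.+1 :> nat) = false by []; rewrite mulr0.
Qed.

Lemma exact_XYs n : exact_kron (Xs n.+1) (Ys n.+1) (Xs n) (Ys n).
Proof.
split; last by rewrite addSnnS.
- rewrite -kermx_eq0; apply/eqP/matrixP => r i; rewrite [RHS]mxE.
  have := mulmx_ker (row_mx (Ys n.+1) (Xs n.+1)).
  move: (kermx _) r => K r; rewrite mul_mx_row -[0]row_mx0 => /eq_row_mx[KY KX].
  case: (unliftP ord0 i) => [j ->|->].
    by have /matrixP/(_ r j) := KY; rewrite mul_Ys mxE.
  have /matrixP/(_ r ord0) := KX; rewrite mul_Xs mxE => <-.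
  by congr (K r _); apply: val_inj.
- apply/row_fullP; exists (row_mx (\matrix_(i, j) (i == j :> nat)%:R) 0).
  by rewrite mul_row_col mul0mx addr0; apply/matrixP=> i j; rewrite mul_Xs !mxE.
rewrite mul_row_col; apply/matrixP=> i j; rewrite mxE mul_Xs mul_Ys !mxE.
by rewrite -mulr2n (mulrn_pchar char2).
Qed.

Lemma lowmx_triv a b (X : 'M[k]_(a, b)) : (a == 0%N) || (b == 0%N) -> lowmx X = 1%:M.
Proof.
move=> ab; rewrite -lowmx0; congr lowmx; apply/matrixP=> i j.
by case/orP: ab => /eqP e; exfalso; [move: i|move: j]; rewrite e => -[].
Qed.

Lemma heller_Xs n : heller (Posz n) (trivial_mod k) (kron_mod char2 (Xs n) (Ys n)).
Proof.
elim: n => [|n IH].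
  by apply: trivial_iso; rewrite ?kron_modg ?kron_modh ?lowmx_triv.
apply: (iter_rel_snoc _ IH); first exact: syzygy_iso.
by apply: kron_syzygy; apply: exact_XYs.
Qed.

Lemma heller_Ys n :
  iter_rel (@cosyzygy k) n (trivial_mod k) (kron_mod char2 (Ys n)^T (Xs n)^T).
Proof.
elim: n => [|n IH].
  by apply: trivial_iso; rewrite ?kron_modg ?kron_modh ?lowmx_triv.
apply: (iter_rel_snoc _ IH); first exact: cosyzygy_iso.
by apply: kron_cosyzygy; apply: exact_kron_tr; apply: exact_XYs.
Qed.

Lemma heller_exists n : exists M, heller n (trivial_mod k) M.
Proof.
case: n => n; first by exists (kron_mod char2 (Xs n) (Ys n)); apply: heller_Xs.
by exists (kron_mod char2 (Ys n.+1)^T (Xs n.+1)^T); apply: heller_Ys.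
Qed.

End Heller.

(** * Fitting's lemma and Jordan blocks *)

Section Commutant.
Variable k : fieldType.

(** For n > 0, indecomposability of k^n as a k[A]-module, expressed by idempotents of the
    commutant. *)
Definition connected_mx n (A : 'M[k]_n) :=
  forall e : 'M[k]_n, e *m A = A *m e -> e *m e = e -> e = 0 \/ e = 1%:M.

Lemma connected_subscalar n (A : 'M[k]_n) a :
  connected_mx A -> connected_mx (A - a%:M).
Proof.
move=> indA e eA ee; apply: indA => //; move: eA.
by rewrite mulmxBl mulmxBr scalar_mxC => /addIr.
Qed.

(* Fitting's lemma: a Bezout relation between X^m and the remaining factor q
   of the characteristic polynomial yields an idempotent in k[A]. *)
Lemma connected_fitting n (A : 'M[k]_n.+1) :
  connected_mx A -> A \in unitmx \/ exists m, A ^+ m = 0.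
Proof.
move=> indA; have [|nuA] := boolP (A \in unitmx); [by left|right].
have [m [q nz_q pE]] := multiplicity_XsubC (char_poly A) 0.
rewrite subr0 in pE.
have q0 : ~~ root q 0.
  by apply: (implyP nz_q); apply: monic_neq0; apply: char_poly_monic.
have /Bezout_eq1_coprimepP [[u v] /= uv] : coprimep q ('X ^+ m).
  by apply: coprimep_expr; rewrite -['X]subr0 coprimep_XsubC.
have Am p : horner_mx A (p * 'X^m) = horner_mx A p *m A ^+ m.
  by rewrite rmorphM rmorphXn /= horner_mx_X.
have qA p : horner_mx A (p * q * 'X^m) = 0.
  by rewrite -mulrA -pE rmorphM /= Cayley_Hamilton mulr0.
have eu := congr1 (horner_mx A) uv; rewrite rmorphD rmorph1 /= in eu.
have [e0|e1] : horner_mx A (v * 'X^m) = 0 \/ horner_mx A (v * 'X^m) = 1%:M.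
- apply: indA; first by apply: comm_horner_mx.
  rewrite -[LHS]/(_ * _) -rmorphM /=.
  have E : v * 'X^m = 1 - u * q by rewrite -uv addrAC subrr add0r.
  have -> : v * 'X^m * (v * 'X^m) = v * 'X^m - u * v * q * 'X^m.
    by rewrite {2}E mulrBr mulr1 [_ * (u * q)]mulrC mulrACA mulrA.
  by rewrite rmorphB /= qA subr0.
- exists m; rewrite e0 addr0 in eu.
  have := qA u; rewrite Am => <-.
  by rewrite eu mul1mx.
case: m pE {uv Am qA eu} e1 => [|m] pE e1.
  move: nuA; rewrite unitmxE unitfE negbK => /eqP detA.
  move: q0; rewrite -[q]mulr1 -[1]/('X^0) -pE /root horner_coef0 char_poly_det detA.
  by rewrite mulr0 eqxx.
rewrite exprSr mulrA rmorphM /= horner_mx_X in e1.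
have /mulmx1_unit [_ uA] := e1.
by rewrite uA in nuA.
Qed.

(* A vector v outside the kernel of A^r and a linear form c with
   v A^s c = (s == r) embed, resp. project onto, a Jordan block. *)
Lemma connected_nilpotent n (A : 'M[k]_n.+1) m :
  connected_mx A -> A ^+ m = 0 ->
  exists U V : 'M[k]_n.+1,
    [/\ U *m V = 1%:M, V *m U = 1%:M & U *m A = N_ k n.+1 *m U].
Proof.
move=> indA Am.
have exm : exists m, A ^+ m == 0 by exists m; apply/eqP.
case: (ex_minnP exm) => -[|r] /eqP {Am} Ar minr.
  by move/eqP: Ar; rewrite expr0 oner_eq0.
have {exm minr} Ar0 : A ^+ r != 0.
  by apply/negP=> /minr; rewrite ltnn.
have [v vr] : exists v : 'rV[k]_n.+1, v *m A ^+ r != 0.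
  have [i vi] : exists i, row i (A ^+ r) != 0.
    apply/existsP; apply: contraR Ar0; rewrite negb_exists => /forallP rows0.
    by apply/eqP/row_matrixP=> i; rewrite row0; apply/eqP/negPn/rows0.
  by exists (delta_mx 0 i); rewrite -rowE.
have big s : (r < s)%N -> A ^+ s = 0.
  by move=> /subnK <-; rewrite exprD Ar mulr0.
pose U : 'M[k]_(r.+1, n.+1) := \matrix_(i, j) (v *m A ^+ (r - i)) 0 j.
have rowU i : row i U = v *m A ^+ (r - i) by apply/rowP=> j; rewrite !mxE.
have UA : U *m A = N_ k r.+1 *m U.
  apply/row_matrixP=> i; rewrite !row_mul rowU.
  rewrite -mulmxA -[_ *m A]/(_ * A) -exprSr; case: (unliftP ord0 i) => [j ->|->].
    have -> : row (lift ord0 j) (N_ k r.+1) = delta_mx 0 (widen_ord (leqnSn _) j).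
      apply/rowP=> l; rewrite mxE N_E mxE eqxx /= eqSS; congr (_%:R).
      by rewrite -val_eqE /= eq_sym.
    by rewrite -rowE rowU /= /bump /= add1n -subSn // subSS.
  rewrite subn0 Ar mulmx0; have -> : row ord0 (N_ k r.+1) = 0.
    by apply/rowP=> l; rewrite mxE N_E mxE.
  by rewrite mul0mx.
have freeU : row_free U.
  rewrite -kermx_eq0; apply/eqP/row_matrixP => i0'; rewrite row0.
  have := mulmx_ker U => /(congr1 (row i0')); rewrite row_mul row0.
  move: (row i0' _) => u uU.
  have uE : \sum_j u 0 j *: (v *m A ^+ (r - j)) = 0.
    by move: uU; rewrite mulmx_sum_row; under eq_bigr => j _ do rewrite rowU.
  (* Applying A^j to the relation isolates the coefficient of index j: smaller indices acquire a
     power beyond r, larger ones vanish by induction. *)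
  have u0 t : forall j : 'I_r.+1, (r - j < t)%N -> u 0 j = 0.
    elim: t => // t IH j rj; move: uE => /(congr1 (mulmxr (A ^+ j))) /=.
    rewrite mul0mx mulmx_suml (bigD1 j) //= big1 => [|l lj].
      rewrite addr0 -scalemxAl -mulmxA -[A ^+ _ *m _]/(_ * _) -exprD subnK -1?ltnS //.
      by move/eqP; rewrite scalemx_eq0 (negPf vr) orbF => /eqP.
    have [lt_lj|lt_jl|/val_inj e] := ltngtP l j; last by rewrite e eqxx in lj.
      rewrite -scalemxAl -mulmxA -[A ^+ _ *m _]/(_ * _) -exprD big ?mulmx0 ?scaler0 //.
      by rewrite -{1}(subnK (_ : l <= r)%N) ?ltn_add2l // -ltnS.
    rewrite IH ?scale0r ?mul0mx // (leq_trans _ (_ : (r - j <= t)%N)) //.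
    by rewrite ltn_sub2l // (leq_trans lt_jl) // -ltnS.
  by apply/rowP=> j; rewrite mxE; apply: (u0 r.+1); rewrite ltnS leq_subr.
have /row_freeP[C UC] := freeU; pose c := C *m delta_mx ord0 0 : 'cV[k]_n.+1.
have vc s : v *m A ^+ s *m c = ((s == r)%:R)%:M.
  have [le_sr|lt_rs] := leqP s r; last first.
    by rewrite (big s) // mulmx0 mul0mx gtn_eqF // raddf0.
  have lt_sr : (r - s < r.+1)%N by rewrite ltnS leq_subr.
  rewrite -[in v *m _](subKn le_sr) -(rowU (Ordinal lt_sr)) mulmxA -row_mul UC row1.
  rewrite mul_delta_mx_cond; apply/rowP=> j; rewrite !mxE !ord1 eqxx mulr1n.
  rewrite -val_eqE /= subn_eq0 eqn_leq le_sr /=.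
  by case: (r <= s)%N; rewrite mxE ?eqxx.
pose V : 'M[k]_(n.+1, r.+1) := \matrix_(i, j) (A ^+ j *m c) i 0.
have AV : A *m V = V *m N_ k r.+1.
  apply/matrixP=> i j; have -> : (A *m V) i j = (A ^+ j.+1 *m c) i 0.
    rewrite exprS -[A * _]/(A *m _) -mulmxA !mxE; apply: eq_bigr => l _.
    by rewrite mxE.
  rewrite [RHS]mxE; have [lt_j|ge_j] := ltnP j.+1 r.+1.
    rewrite (bigD1 (Ordinal lt_j)) //= big1 => [|l /negPf lj].
      by rewrite N_E /= eqxx mulr1 addr0 [RHS]mxE.
    by rewrite N_E; have -> : (l == j.+1 :> nat) = false by []; rewrite mulr0.
  rewrite big // mul0mx mxE big1 // => l _; rewrite N_E ltn_eqF ?mulr0 //.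
  exact: leq_trans (ltn_ord l) ge_j.
have UV : U *m V = 1%:M.
  apply/matrixP=> i j; have -> : (U *m V) i j = (v *m A ^+ (r - i) *m (A ^+ j *m c)) 0 0.
    by rewrite !mxE; apply: eq_bigr => l _; rewrite !mxE.
  rewrite mulmxA -(mulmxA v) -[A ^+ _ *m _]/(_ * _) -exprD vc !mxE eqxx mulr1n.
  have le_ir : (i <= r)%N by rewrite -ltnS.
  have -> : (r - i + j == r)%N = (r - i + j == r - i + i)%N by rewrite subnK.
  by rewrite eqn_add2l eq_sym.
have VU : V *m U = 1%:M.
  have [] // : V *m U = 0 \/ V *m U = 1%:M.
    apply: indA; last by rewrite mulmxA -(mulmxA V) UV mulmx1.
    by rewrite -mulmxA UA mulmxA -AV !mulmxA.
  move=> VU0; have : U *m V *m (U *m V) = 0.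
    by rewrite mulmxA -(mulmxA U) VU0 mulmx0 mul0mx.
  rewrite UV mulmx1 => /matrixP/(_ ord0 ord0)/eqP.
  by rewrite !mxE eqxx oner_eq0.
have er : r = n.
  have freeV : row_free V by apply/row_freeP; exists U.
  apply/eqP; rewrite -eqSS eqn_leq; apply/andP; split.
    by move/eqP: freeU => {1}<-; apply: rank_leq_col.
  by move/eqP: freeV => {1}<-; apply: rank_leq_col.
by subst r; exists U, V.
Qed.

End Commutant.

(* The coefficients v_i of a polynomial null vector of X + lambda Y. *)
Lemma singular_pencil (k : closedFieldType) (char2 : 2%N \in [pchar k]) n (X Y : 'M[k]_n) :
  (exists a, X + a *: Y \in unitmx) \/
  exists d (v : nat -> 'rV[k]_n),
    [/\ v 0%N *m X = 0, forall i, v i.+1 *m X = v i *m Y,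
        forall i, (d <= i)%N -> v i = 0 & exists i, v i != 0].
Proof.
pose A : 'M[{poly k}]_n := map_mx polyC X + 'X *: map_mx polyC Y.
have [/eqP/det0P[w w0 wA]|/closed_nonrootP[a]] := eqVneq (\det A) 0; last first.
  move=> nr; left; exists a; rewrite unitmxE unitfE.
  suff -> : X + a *: Y = map_mx (horner_eval a) A.
    by rewrite det_map_mx.
  by apply/matrixP=> i j; rewrite !mxE /horner_eval hornerD hornerM hornerX !hornerC.
right; pose v i : 'rV[k]_n := \row_j (w 0 j)`_i.
have coefwA i j : ((w *m A) 0 j)`_i = (v i *m X) 0 j + (if i is i'.+1 then (v i' *m Y) 0 j else 0).
  rewrite mxE coef_sum; case: i => [|i].
    rewrite addr0 mxE; apply: eq_bigr => l _.
    by rewrite !mxE mulrDr coefD mulrCA coefXM /= addr0 coefMC.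
  rewrite !mxE -big_split; apply: eq_bigr => l _.
  by rewrite !mxE mulrDr coefD mulrCA coefXM /= !coefMC.
exists (\max_(j < n) size (w 0%R j)), v; split.
- by apply/rowP=> j; have := coefwA 0%N j; rewrite wA !mxE coef0 addr0.
- move=> i; apply/rowP=> j; have := coefwA i.+1 j; rewrite wA mxE coef0.
  move/esym/eqP; rewrite addr_eq0 => /eqP ->.
  by rewrite (oppr_pchar2 char2).
- move=> i di; apply/rowP=> j; rewrite !mxE nth_default //.
  by apply: leq_trans di; apply: leq_bigmax.
have /rV0Pn[j wj] := w0; exists (size (w 0 j)).-1.
by apply/rV0Pn; exists j; rewrite mxE -lead_coefE lead_coef_eq0.
Qed.

(** * Indecomposable pairs of matrices *)

Section KroneckerClassification.
Variable k : closedFieldType.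
Hypothesis char2 : 2%N \in [pchar k].

Lemma kron_iso a b (X Y X1 Y1 : 'M[k]_(a, b)) f f' g g' :
  f *m f' = 1%:M -> f' *m f = 1%:M -> g *m g' = 1%:M -> g' *m g = 1%:M ->
  f *m X1 = X *m g -> f *m Y1 = Y *m g ->
  iso (kron_mod char2 X Y) (kron_mod char2 X1 Y1).
Proof.
move=> ff' f'f gg' g'g fX fY.
have hom_block (U V U1 V1 : 'M[k]_(a, b)) u w : u *m U1 = U *m w -> u *m V1 = V *m w ->
    @is_hom k (kron_mod char2 U V) (kron_mod char2 U1 V1) (block_mx w 0 0 u).
  move=> uU uV; apply: (gen_hom generators_gh);
    rewrite ?kron_modg ?kron_modh /lowmx !mulmx_block;
    by rewrite !(mul0mx, mulmx0, mul1mx, mulmx1, add0r, addr0) (uU, uV).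
have inv_eq (U U1 : 'M[k]_(a, b)) : f *m U1 = U *m g -> f' *m U = U1 *m g'.
  move=> e; rewrite -[U]mulmx1 -gg' (mulmxA U) -e !mulmxA f'f mul1mx; reflexivity.
apply/isoP; exists (block_mx g 0 0 f), (block_mx g' 0 0 f'); split.
- exact: hom_block.
- by apply: hom_block; apply: inv_eq.
- by rewrite mulmx_block !(mul0mx, mulmx0, add0r, addr0) gg' ff' -scalar_mx_block.
- by rewrite mulmx_block !(mul0mx, mulmx0, add0r, addr0) g'g f'f -scalar_mx_block.
Qed.

(** Indecomposability through idempotent endomorphisms of the pair; in this form it passes to
    transposes and along [exact_kron] without constructing summands. *)
Definition kindec a b (X Y : 'M[k]_(a, b)) := forall f g,
  f *m f = f -> g *m g = g -> f *m X = X *m g -> f *m Y = Y *m g ->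
  (f = 0 /\ g = 0) \/ (f = 1%:M /\ g = 1%:M).

Lemma indecomposable_kindec a b (X Y : 'M[k]_(a, b)) :
  indecomposable (kron_mod char2 X Y) -> kindec X Y.
Proof.
move=> indM f g ff gg fX fY; pose e : 'M[k]_(b + a) := block_mx g 0 0 f.
have he : @is_hom k (kron_mod char2 X Y) (kron_mod char2 X Y) e.
  apply: (gen_hom generators_gh); rewrite ?kron_modg ?kron_modh /lowmx !mulmx_block;
    by rewrite !(mul0mx, mulmx0, mul1mx, mulmx1, add0r, addr0) (fX, fY).
have ee : e *m e = e.
  by rewrite mulmx_block !(mul0mx, mulmx0, add0r, addr0) gg ff.
case: (indecomposable_idempotent indM he ee) => E; [left|right]; move: E.
  by rewrite -[0](@block_mx0 _ b a b a) => /eq_block_mx[-> _ _ ->].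
by rewrite /= (scalar_mx_block b a) => /eq_block_mx[-> _ _ ->].
Qed.

Lemma kindec_tr a b (X Y : 'M[k]_(a, b)) : kindec X Y -> kindec Y^T X^T.
Proof.
move=> indXY f g ff gg fY gX.
have trE (U : 'M[k]_(a, b)) : f *m U^T = U^T *m g -> g^T *m U = U *m f^T.
  by move=> e; rewrite -[U]trmxK -!trmx_mul e.
have := indXY g^T f^T; rewrite -!trmx_mul ff gg => /(_ erefl erefl (trE _ gX) (trE _ fY)).
have tr_inj m n (U V : 'M[k]_(m, n)) : U^T = V^T -> U = V.
  by move/(congr1 trmx); rewrite !trmxK.
case=> -[Eg Ef]; [left|right]; split; apply: tr_inj;
  by rewrite ?trmx0 ?trmx1.
Qed.

(** A vector v killed by X and Y would split off: the projection c v onto its line, paired with 0 on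
    k^b, is an idempotent that is neither 0 nor, as b > 0, the identity. *)
Lemma kindec_free a b (X Y : 'M[k]_(a, b)) :
  (0 < b)%N -> kindec X Y -> row_free (row_mx Y X).
Proof.
move=> b0 indXY; rewrite -kermx_eq0; apply/negPn/negP => /rowV0Pn[v].
move=> /sub_kermxP; rewrite mul_mx_row -[0](@row_mx0 _ 1 b b) => /eq_row_mx[vY vX] nz_v.
have [c vc] : exists c : 'cV_a, v *m c = 1%:M.
  have : row_free v by rewrite /row_free rank_rV nz_v.
  by case/row_freeP=> c vc; exists c.
have := indXY (c *m v) 0; rewrite mulmxA -(mulmxA c) vc mulmx1 !mulmx0 -!mulmxA vX vY !mulmx0.
case=> // -[].
  move=> cv0 _; have : v *m (c *m v) = 0 by rewrite cv0 mulmx0.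
  by rewrite mulmxA vc mul1mx => v0; rewrite v0 eqxx in nz_v.
move=> _ /matrixP/(_ (Ordinal b0) (Ordinal b0))/eqP.
by rewrite !mxE eqxx eq_sym oner_eq0.
Qed.

(** An idempotent (g, g') of the cokernel pair makes g + g preserve the kernel k^a, inducing an
    idempotent f there; surjectivity onto k^c lets g determine g'. *)
Lemma kindec_exact a b c (X Y : 'M[k]_(a, b)) (X' Y' : 'M[k]_(b, c)) :
  exact_kron X Y X' Y' -> kindec X Y -> kindec X' Y'.
Proof.
move=> [freeXY fullXY XY0 abc] indXY g g' gg g'g' gX gY.
have kerE : (kermx (col_mx X' Y') <= row_mx Y X)%MS.
  have sub : (row_mx Y X <= kermx (col_mx X' Y'))%MS by apply/sub_kermxP.
  have [_] := mxrank_leqif_sup sub => <-.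
  by rewrite mxrank_ker (eqP freeXY) (eqP fullXY) -abc addnK.
have XY0' : Y *m X' + X *m Y' = 0 by rewrite -mul_row_col.
have : (row_mx (Y *m g) (X *m g) <= row_mx Y X)%MS.
  apply: submx_trans kerE; apply/sub_kermxP.
  by rewrite mul_row_col -!mulmxA gX gY !mulmxA -mulmxDl XY0' mul0mx.
case/submxP=> f; rewrite mul_mx_row => /eq_row_mx[fY fX].
have ff : f *m f = f.
  apply: (row_free_inj freeXY); rewrite -mulmxA !mul_mx_row -fY -fX.
  by rewrite !mulmxA -fY -fX -!mulmxA gg.
have [z|o] := indXY f g ff gg (esym fX) (esym fY).
  left; split; first by case: z.
  have /row_fullP[B BC] := fullXY; rewrite -[g']mul1mx -BC -mulmxA mul_col_mx -gX -gY.
  by case: z => _ ->; rewrite !mul0mx col_mx0 mulmx0.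
right; split; first by case: o.
have /row_fullP[B BC] := fullXY; rewrite -[g']mul1mx -BC -mulmxA mul_col_mx -gX -gY.
by case: o => _ ->; rewrite !mul1mx BC.
Qed.

Lemma exact_kron_exists a b (X Y : 'M[k]_(a, b)) : row_free (row_mx Y X) ->
  exists c (X' Y' : 'M[k]_(b, c)), exact_kron X Y X' Y'.
Proof.
move=> freeXY; set A := row_mx Y X in freeXY.
exists (\rank (cokermx A)).
exists (usubmx (col_base (cokermx A))), (dsubmx (col_base (cokermx A))).
rewrite /exact_kron vsubmxK; split=> //.
- by rewrite /row_full; have := col_base_full (cokermx A).
- have /row_freeP[B CB] := row_base_free (cokermx A).
  by rewrite -[LHS]mulmx1 -CB mulmxA -(mulmxA A) mulmx_base mulmx_coker mul0mx.
rewrite mxrank_coker (eqP freeXY) subnKC //.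
by rewrite -{1}(eqP freeXY) rank_leq_col.
Qed.

Lemma kindec_degree1 a (X Y : 'M[k]_(a, 0)) : (0 < a)%N -> kindec X Y -> a = 1%N.
Proof.
move=> a0 indXY; pose i0 := Ordinal a0.
have thin (U U' : 'M[k]_(a, 0)) : U = U' by rewrite [U]thinmx0 [U']thinmx0.
case: (indXY (delta_mx i0 i0) 0 (mul_delta_mx _ _ _) (mulmx0 _ 0) (thin _ _) (thin _ _)).
  by move=> [/matrixP/(_ i0 i0)/eqP]; rewrite !mxE !eqxx oner_eq0.
by move=> [E _]; rewrite -[LHS](mxrank1 k) -E mxrank_delta.
Qed.

(** The new pair has c = 2b - a < b, so the inequality persists and the socle shrinks; at b = 0 only
    the trivial module is indecomposable. *)
Lemma kindec_heller a b (X Y : 'M[k]_(a, b)) : (b < a)%N -> kindec X Y ->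
  exists n, iter_rel (@syzygy k) n (trivial_mod k) (kron_mod char2 X Y).
Proof.
have [m] := ubnP b; elim: m => // m IH in a b X Y *; rewrite ltnS => le_bm lt_ba indXY.
case: b => [|b] in X Y le_bm lt_ba indXY *.
  have a1 := kindec_degree1 lt_ba indXY.
  subst a; exists 0%N; apply: trivial_iso; rewrite ?kron_modg ?kron_modh ?lowmx_triv //.
have freeXY := kindec_free (ltn0Sn b) indXY.
have [c [X' [Y' ex]]] := exact_kron_exists freeXY.
have [_ _ _ abc] := ex.
have lt_cb : (c < b.+1)%N by rewrite -(ltn_add2l b.+1) -abc ltn_add2r.
have [n Hn] := IH _ _ X' Y' (leq_trans lt_cb le_bm) lt_cb (kindec_exact ex indXY).
exists n.+1; apply: (iter_rel_snoc _ Hn); first exact: syzygy_iso.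
exact: kron_syzygy.
Qed.

Lemma kindec_coheller a b (X Y : 'M[k]_(a, b)) : (a < b)%N -> kindec X Y ->
  exists n, iter_rel (@cosyzygy k) n (trivial_mod k) (kron_mod char2 X Y).
Proof.
have [m] := ubnP a; elim: m => // m IH in a b X Y *; rewrite ltnS => le_am lt_ab indXY.
case: a => [|a] in X Y le_am lt_ab indXY *.
  have b1 := kindec_degree1 lt_ab (kindec_tr indXY).
  subst b; exists 0%N; apply: trivial_iso; rewrite ?kron_modg ?kron_modh ?lowmx_triv //.
have indT := kindec_tr indXY.
have [c [X' [Y' ex]]] := exact_kron_exists (kindec_free (ltn0Sn a) indT).
have [_ _ _ abc] := ex.
have lt_ca : (c < a.+1)%N by rewrite -(ltn_add2l a.+1) -abc ltn_add2r.
have indT' := kindec_tr (kindec_exact ex indT).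
have ex' := exact_kron_tr ex; rewrite !trmxK in ex'.
have [n Hn] := IH _ _ _ _ (leq_trans lt_ca le_am) lt_ca indT'.
exists n.+1; apply: (iter_rel_snoc _ Hn); first exact: cosyzygy_iso.
exact: kron_cosyzygy.
Qed.

(* Passing to the cosyzygy replaces the null vector v(lambda) of the pencil
   by v(lambda) Y, which is shorter by one. *)
Lemma kindec_no_null_vector n d (X Y : 'M[k]_n.+1) (v : nat -> 'rV[k]_n.+1) :
  kindec X Y -> v 0%N *m X = 0 -> (forall i, v i.+1 *m X = v i *m Y) ->
  (forall i, (d <= i)%N -> v i = 0) -> forall i, v i = 0.
Proof.
elim: d X Y v => [|d IH] X Y v indXY v0 vS vd i; first exact: vd.
have freeXY := kindec_free (ltn0Sn n) indXY.
have [c [X' [Y' ex]]] := exact_kron_exists freeXY.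
have [_ _ XY0 /addnI ec] := ex; subst c.
have YX' : Y *m X' = X *m Y'.
  apply/eqP; rewrite -subr_eq0 oppmm //; apply/eqP.
  by move: XY0; rewrite mul_row_col.
have vY j : v j *m Y = 0.
  apply: (IH X' Y' (fun j => v j *m Y) (kindec_exact ex indXY)) => {j}.
  - by rewrite -mulmxA YX' mulmxA v0 mul0mx.
  - by move=> j; rewrite -mulmxA YX' mulmxA vS.
  by move=> j dj; rewrite -vS vd ?mul0mx.
have vX : v i *m X = 0 by case: i => // i; rewrite vS.
apply: (row_free_inj freeXY); rewrite mul0mx mul_mx_row vX vY; exact: row_mx0.
Qed.

Lemma kron_VSome n a : iso (kron_mod char2 1%:M (N_ k n + a%:M)) (Vmod char2 n (Some a)).
Proof.
apply/isoP; exists 1%:M, 1%:M.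
have h1 : @is_hom k (kron_mod char2 1%:M (N_ k n + a%:M)) (Vmod char2 n (Some a)) 1%:M.
  apply: (gen_hom generators_gh); rewrite mul1mx mulmx1 ?kron_modg ?kron_modh.
    by apply/esym; apply: etrans (Vmod_gen1 char2 n (Some a)) _.
  apply/esym; apply: etrans (Vmod_gen2 char2 n (Some a)) _.
  by rewrite /= Jordan_tr.
split; [exact: h1| |exact: mulmx1|exact: mulmx1].
by move=> z z4; have := h1 z z4; rewrite mul1mx mulmx1 => ->; rewrite mul1mx mulmx1.
Qed.

Lemma kron_VNone n : iso (kron_mod char2 (N_ k n) 1%:M) (Vmod char2 n None).
Proof.
apply/isoP; exists 1%:M, 1%:M.
have h1 : @is_hom k (kron_mod char2 (N_ k n) 1%:M) (Vmod char2 n None) 1%:M.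
  apply: (gen_hom generators_gh); rewrite mul1mx mulmx1 ?kron_modg ?kron_modh.
    apply/esym; apply: etrans (Vmod_gen2 char2 n None) _.
    by rewrite /= Jordan_tr raddf0 addr0.
  by apply/esym; apply: etrans (Vmod_gen1 char2 n None) _.
split; [exact: h1| |exact: mulmx1|exact: mulmx1].
by move=> z z4; have := h1 z z4; rewrite mul1mx mulmx1 => ->; rewrite mul1mx mulmx1.
Qed.

(** An idempotent e commuting with J extends to the pair (e, Z^(-1) e Z). The four scalars cover the
    normalisations by X, by Y and by X + s Y at once. *)
Lemma kindec_pencil n (X Y Z J : 'M[k]_n) a b c d : kindec X Y ->
  X = (a *: J + b%:M) *m Z -> Y = (c *: J + d%:M) *m Z -> Z \in unitmx -> connected_mx J.
Proof.
move=> indXY XE YE uZ e eJ ee.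
have eP (s t : k) : e *m ((s *: J + t%:M) *m Z) = (s *: J + t%:M) *m Z *m (invmx Z *m e *m Z).
  have eT : e *m (s *: J + t%:M) = (s *: J + t%:M) *m e.
    by rewrite mulmxDr mulmxDl -scalemxAr -scalemxAl eJ scalar_mxC.
  by rewrite !mulmxA mulmxK // eT.
have := indXY e (invmx Z *m e *m Z); rewrite XE YE => /(_ ee) [].
- by rewrite !mulmxA mulmxK // -(mulmxA _ e e) ee.
- exact: eP.
- exact: eP.
- by case; left.
by case; right.
Qed.

Lemma nilpotent_unit n (J : 'M[k]_n.+1) m s : J ^+ m = 0 -> 1%:M - s *: J \in unitmx.
Proof.
move=> Jm; have := subrXX_comm m (commr_sym (commr1 (s *: J))).
by rewrite exprZn Jm scaler0 expr1n subr0 => /esym/mulmx1_unit[].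
Qed.

(** The pencil is regular, so X + s Y is invertible for some s. If X is invertible, Y X^(-1) is a
    single Jordan block with some eigenvalue a. Otherwise Y is invertible, and X Y^(-1) is a
    nilpotent block, the case of oo. *)
Lemma kindec_V n (X Y : 'M[k]_n.+1) : kindec X Y ->
  exists c, iso (kron_mod char2 X Y) (Vmod char2 n.+1 c).
Proof.
move=> indXY.
have [[s uZ]|[d [v [v0 vS vd [i]]]]] := singular_pencil char2 X Y; last first.
  by rewrite (kindec_no_null_vector indXY v0 vS vd) eqxx.
have [uX|nuX] := boolP (X \in unitmx).
  pose J := Y *m invmx X.
  have YE : Y = J *m X by rewrite mulmxKV.
  have indJ : connected_mx J.
    apply: (@kindec_pencil _ X Y X J 0 1 1 0) => //.
      by rewrite scale0r add0r mul1mx.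
    by rewrite scale1r raddf0 addr0.
  have [a] : exists a, root (char_poly J) a.
    by apply/closed_rootP; rewrite size_char_poly.
  rewrite -eigenvalue_root_char => /eigenvalueP[w wJ nz_w].
  have [uJ|[m Jm]] := connected_fitting (connected_subscalar (a := a) indJ).
    case/negP: nz_w; rewrite -[w](mulmxK uJ) mulmxBr wJ mul_mx_scalar subrr.
    by rewrite mul0mx.
  have [U [V [UV VU UJ]]] := connected_nilpotent (connected_subscalar (a := a) indJ) Jm.
  exists (Some a); apply: (iso_trans _ (kron_VSome n.+1 a)).
  apply: (@kron_iso _ _ _ _ _ _ V U (invmx X *m V) (U *m X)) => //.
  - by rewrite mulmxA -(mulmxA _ V) VU mulmx1 mulVmx.
  - by rewrite mulmxA -(mulmxA U) mulmxV // mulmx1.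
  - by rewrite mulmx1 mulmxA mulmxV // mul1mx.
  rewrite mulmxA -/J -[RHS]mul1mx -VU -mulmxA; congr (V *m _).
  rewrite -[J in RHS](subrK a%:M) mulmxA mulmxDr UJ mulmxDl.
  by rewrite scalar_mxC -!mulmxA UV !mulmx1.
pose Z := X + s *: Y; pose J := Y *m invmx Z.
have YE : Y = J *m Z by rewrite mulmxKV.
have XE : X = (1%:M - s *: J) *m Z.
  by rewrite mulmxBl mul1mx -scalemxAl -YE addrK.
have indJ : connected_mx J.
  apply: (@kindec_pencil _ X Y Z J (- s) 1 1 0) => //.
    by rewrite scaleNr addrC.
  by rewrite scale1r raddf0 addr0.
(* By Fitting J is invertible or nilpotent, and in the nilpotent case X = (1 - s J) Z would be
   invertible. *)
have uY : Y \in unitmx.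
  have [uJ|[m Jm]] := connected_fitting indJ; first by rewrite YE unitmx_mul uJ.
  by case/negP: nuX; rewrite XE unitmx_mul (nilpotent_unit s Jm).
pose K := X *m invmx Y.
have XK : X = K *m Y by rewrite mulmxKV.
have indK : connected_mx K.
  apply: (@kindec_pencil _ X Y Y K 1 0 0 1) => //.
    by rewrite scale1r raddf0 addr0.
  by rewrite scale0r add0r mul1mx.
have [uK|[m Km]] := connected_fitting indK.
  by case/negP: nuX; rewrite XK unitmx_mul uK.
have [U [V [UV VU UK]]] := connected_nilpotent indK Km.
exists None; apply: (iso_trans _ (kron_VNone n.+1)).
apply: (@kron_iso _ _ _ _ _ _ V U (invmx Y *m V) (U *m Y)) => //.
- by rewrite mulmxA -(mulmxA _ V) VU mulmx1 mulVmx.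
- by rewrite mulmxA -(mulmxA U) mulmxV // mulmx1.
- rewrite mulmxA -/K -[RHS]mul1mx -VU -mulmxA; congr (V *m _).
  by rewrite mulmxA UK -mulmxA UV mulmx1.
by rewrite mulmx1 mulmxA mulmxV // mul1mx.
Qed.

End KroneckerClassification.

(** * Indecomposable modules and the list of containments *)

Section Classification.
Variable k : closedFieldType.
Hypothesis char2 : 2%N \in [pchar k].
Implicit Types M N L P W : kV4mod k.

Lemma indecomposable_iso M N : iso M N -> indecomposable M -> indecomposable N.
Proof.
move=> MN [nzM indM]; split; first by rewrite /nonzero -(mxrank_rsim MN).
by move=> L L' NL; apply: indM; apply: iso_trans NL.
Qed.

Lemma nilp_sqr M z : (M z + 1%:M) *m (M z + 1%:M) = 0.
Proof.
by rewrite mulmxDl mul1mx mulmxDr kV4_sqr mulmx1 [1%:M + _]addrC addmm.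
Qed.

Lemma nilp_comm M z w :
  (M z + 1%:M) *m (M w + 1%:M) = (M w + 1%:M) *m (M z + 1%:M).
Proof.
rewrite !mulmxDl !mulmxDr !mulmx1 !mul1mx (kV4_comm M z w) -!addrA.
by congr (_ + _); rewrite addrCA.
Qed.

(* A vector v with v x y <> 0 generates a free submodule, which splits off
   because kV_4 is self-injective. *)
Lemma indecomposable_D M : indecomposable M ->
  (M g4 + 1%:M) *m (M h4 + 1%:M) != 0 -> iso M (Dmod k).
Proof.
set x := M g4 + 1%:M; set y := M h4 + 1%:M => indM xy0.
have [v vxy] : exists v : 'rV[k]_(rdegree M), v *m (x *m y) != 0.
  have [i vi] : exists i, row i (x *m y) != 0.
    apply/existsP; apply: contraR xy0; rewrite negb_exists => /forallP rows0.
    by apply/eqP/row_matrixP=> i; rewrite row0; apply/eqP/negPn/rows0.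
  by exists (delta_mx 0 i); rewrite -rowE.
pose i : 'M[k]_(#|V4|, rdegree M) := \matrix_(z, j) (v *m M (enum_val z)) 0 j.
have rowi z : row z i = v *m M (enum_val z) by apply/rowP=> j; rewrite !mxE.
have hi : @is_hom k (Dmod k) M i.
  move=> w w4; apply/row_matrixP=> z; rewrite !row_mul rowi /= rowK -rowE rowi.
  by rewrite gring_indexK // repr_mxM // mulmxA.
have free_i : row_free i.
  rewrite -kermx_eq0; apply/eqP/row_matrixP=> r; rewrite row0.
  have := congr1 (row r) (mulmx_ker i); rewrite row_mul row0.
  move: (row r _) => u; rewrite mulmx_sum_row.
  rewrite (reindex (gring_index V4)) /=; last first.
    by exists enum_val => z _; [exact: gring_indexK|exact: gring_valK].
  under eq_bigr => z _ do rewrite rowi gring_indexK //.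
  rewrite sum_V4 repr_mx1 mulmx1 repr_mxM //.
  have Mg : M g4 = x + 1%:M by rewrite addmmK.
  have Mh : M h4 = y + 1%:M by rewrite addmmK.
  rewrite Mg Mh.
  set al := u 0 _; set be := u 0 (gring_index V4 g4).
  set ga := u 0 (gring_index V4 h4); set de := u 0 _ => rel.
  have xx : x *m x = 0 by apply: nilp_sqr.
  have yy : y *m y = 0 by apply: nilp_sqr.
  have yx : y *m x = x *m y by apply: nilp_comm.
  (* The relation among the v z is rewritten in terms of v, v x, v y, v xy; multiplying by xy, then
     y, then x isolates one coefficient after another. *)
  have rel2 : (al + be + ga + de) *: v + (be + de) *: (v *m x) +
      (ga + de) *: (v *m y) + de *: (v *m (x *m y)) = 0.
    rewrite -[RHS]rel; clearbody x y; rewrite !(mulmxDr, mulmxDl, mulmx1, mul1mx).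
    by apply/rowP=> j; rewrite ![in RHS]mxE ![in LHS]mxE; ring.
  have coef0 c : c *: (v *m (x *m y)) = 0 -> c = 0.
    by move/eqP; rewrite scalemx_eq0 (negPf vxy) orbF => /eqP.
  clearbody x y.
  have xxy : x *m (x *m y) = 0 by rewrite mulmxA xx mul0mx.
  have yxy : y *m (x *m y) = 0 by rewrite mulmxA yx -mulmxA yy mulmx0.
  have mul_rel w := congr1 (mulmxr w) rel2.
  have s1 : al + be + ga + de = 0.
    apply: coef0; have := mul_rel _ (x *m y).
    by rewrite /= !mulmxDl -!scalemxAl -!mulmxA xxy yxy !(mulmx0, scaler0, addr0, mul0mx).
  have s2 : be + de = 0.
    apply: coef0; have := mul_rel _ y.
    by rewrite s1 scale0r add0r /= !mulmxDl -!scalemxAl -!mulmxA yy !(mulmx0, scaler0, addr0, mul0mx).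
  have s3 : ga + de = 0.
    apply: coef0; have := mul_rel _ x.
    by rewrite s1 s2 !scale0r !add0r /= !mulmxDl -!scalemxAl -!mulmxA yx xxy !(mulmx0, scaler0, addr0, mul0mx).
  have de0 : de = 0 by apply: coef0; move: rel2; rewrite s1 s2 s3 !scale0r !add0r.
  rewrite de0 addr0 in s2; rewrite de0 addr0 in s3; rewrite de0 s2 s3 !addr0 in s1.
  apply/rowP=> j; rewrite mxE -[j](gring_valK).
  by case: (generators_gh (enum_val j)) => ->.
have [f hf fi] := higman_injective (higman_Dmod k) hi free_i (@is_hom1 _ (Dmod k)).
apply: indecomposable_retract => //; first exact: cardG_gt0.
by exists i, f.
Qed.

(** When xy = 0, the radical S = M x + M y is killed by x and y, so in a basis of S followed by one
    of a complement both generators become [lowmx]. *)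
Lemma indecomposable_kron M : (M g4 + 1%:M) *m (M h4 + 1%:M) = 0 ->
  exists a b (X Y : 'M[k]_(a, b)), iso M (kron_mod char2 X Y).
Proof.
set x := M g4 + 1%:M; set y := M h4 + 1%:M => xy.
have Mg : M g4 = 1%:M + x by rewrite addrC addmmK.
have Mh : M h4 = 1%:M + y by rewrite addrC addmmK.
have yx : y *m x = 0 by rewrite nilp_comm.
have xx : x *m x = 0 by apply: nilp_sqr.
have yy : y *m y = 0 by apply: nilp_sqr.
pose S := col_mx x y; pose Bs := row_base S; pose Bt := row_base (S^C)%MS.
have Bs0 z : x *m z = 0 -> y *m z = 0 -> Bs *m z = 0.
  move=> xz yz; have /submxP[C ->] : (Bs <= S)%MS by rewrite eq_row_base.
  by rewrite -mulmxA mul_col_mx xz yz col_mx0 mulmx0.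
have /submxP[X XE] : (Bt *m x <= Bs)%MS.
  by rewrite eq_row_base (submx_trans (submxMl _ _)) // /S -addsmxE addsmxSl.
have /submxP[Y YE] : (Bt *m y <= Bs)%MS.
  by rewrite eq_row_base (submx_trans (submxMl _ _)) // /S -addsmxE addsmxSr.
exists (\rank (S^C)%MS), (\rank S), X, Y; apply: iso_sym.
have homB : @is_hom k (kron_mod char2 X Y) M (col_mx Bs Bt).
  apply: (gen_hom generators_gh); rewrite ?kron_modg ?kron_modh (Mg, Mh) mulmxDr mulmx1;
    rewrite mul_block_col !mul_col_mx !mul1mx mul0mx addr0 add_col_mx -(XE, YE) Bs0 //;
    by rewrite addr0 [X in _ = col_mx _ X]addrC.
exists (col_mx Bs Bt) => //=.
  by rewrite mxrank_compl subnKC // rank_leq_col.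
rewrite /row_free -addsmxE (adds_eqmx (eq_row_base _) (eq_row_base _)).
by rewrite (eqP (addsmx_compl_full S)) mxrank_compl subnKC // rank_leq_col.
Qed.

Lemma indecomposable_classification M : indecomposable M ->
  [\/ iso M (Dmod k), exists n, heller n (trivial_mod k) M |
      exists n c, (0 < n)%N /\ iso M (Vmod char2 n c)].
Proof.
move=> indM; have [/indecomposable_kron|/(indecomposable_D indM)] :=
  eqVneq ((M g4 + 1%:M) *m (M h4 + 1%:M)) 0; last by constructor 1.
move=> [a [b [X [Y MXY]]]]; have indXY := indecomposable_iso MXY indM.
have kindXY := indecomposable_kindec indXY.
have [lt_ab|lt_ba|eab] := ltngtP a b.
- constructor 2; have [n Hn] := kindec_coheller char2 lt_ab kindXY.
  (* [Negz] starts at -1, so a chain of no cosyzygies is recorded as the shift by 0. *)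
  case: n Hn => [|n] Hn; [exists (Posz 0)|exists (Negz n)];
    by apply: heller_iso (iso_sym MXY).
- constructor 2; have [n Hn] := kindec_heller char2 lt_ba kindXY.
  by exists (Posz n); apply: heller_iso (iso_sym MXY).
subst b; case: a X Y MXY indXY kindXY => [|n] X Y MXY [nzXY _] kindXY.
  by [].
constructor 3; have [c Vc] := kindec_V char2 kindXY; exists n.+1, c; split=> //.
exact: iso_trans Vc.
Qed.

Lemma rt_iso M N : iso M N -> clos_refl_trans (kV4mod k) (listed char2) M N.
Proof. by move=> MN; apply: rt_step; apply: listed_iso. Qed.

Lemma heller_containments n M N :
  heller n (trivial_mod k) N ->
  (exists n', heller n' (trivial_mod k) M) \/
  (exists m c, (0 < m)%N /\ iso M (Vmod char2 m c)) ->
  clos_refl_trans (kV4mod k) (listed char2) M N.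
Proof.
move=> HN HM; apply: (rt_trans _ _ _ (trivial_mod k)); last first.
  by apply: rt_step; apply: listed_k_Omega HN.
case: HM => [[n' HM]|[m [c [m0 MV]]]].
  by apply: rt_step; apply: listed_Omega_k HM.
apply: rt_trans (rt_iso MV) _; apply: rt_step; exact: listed_V_k.
Qed.

Lemma containment_listed M N : indecomposable M -> indecomposable N ->
  ideal_of M `<=` ideal_of N -> clos_refl_trans (kV4mod k) (listed char2) M N.
Proof.
move=> indM indN sMN.
have notD L : iso L (Dmod k) -> ideal_of L = Proj k by move/iso_ideal_of ->; rewrite ProjE.
have nonproj m c : (0 < m)%N -> ~ ideal_of (Vmod char2 m c) `<=` Proj k.
  by move=> m0 /(_ _ (ideal_of_refl _)); apply: Vmod_not_projective.
have kProj : ~ Proj k (trivial_mod k).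
  by move=> /projectiveP /(higman_even char2) /eqP; rewrite oner_eq0.
case: (indecomposable_classification indM) => [MD|[m HM]|[m [c [m0 MV]]]].
- apply: rt_trans (rt_iso MD) _; apply: rt_step; exact: listed_D.
(* Once the ideal of N contains k, N can be neither D nor a V_n, and only a Heller shift remains. *)
- have kN : ideal_of N (trivial_mod k) by apply: sMN; rewrite (heller_ideal_of char2 HM).
  case: (indecomposable_classification indN) => [ND|[n HN]|[n [c [n0 NV]]]].
  + by rewrite notD // in kN.
  + by apply: heller_containments HN _; left; exists m.
  by case: (trivial_notin_V (char2 := char2) (c := c) n0); rewrite -(iso_ideal_of NV).
case: (indecomposable_classification indN) => [ND|[n HN]|[n [c' [n0 NV]]]].
- by case: (@nonproj m c m0); rewrite -(notD N ND) -(iso_ideal_of MV).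
- by apply: heller_containments HN _; right; exists m, c.
rewrite (iso_ideal_of MV) (iso_ideal_of NV) in sMN.
have [ec le_mn] := Vmod_sub_inv m0 n0 sMN; subst c'.
apply: rt_trans (rt_iso MV) _; apply: rt_trans _ (rt_iso (iso_sym NV)).
have [lt_mn|lt_nm|->] := ltngtP m n; last exact: rt_refl.
  by apply: rt_step; apply: listed_V; rewrite m0.
(* The bound allows m > n only if n = 1, m = 2 and the point is not rational, which is the
   exceptional entry [listed_V2_V1]. *)
move: le_mn; rewrite /kill_exponent; case: ifP => [_|]; first by rewrite leqNgt lt_nm.
move/negbT; rewrite negb_or -leqNgt => /andP[irr n1] le_m.
have en : n = 1%N by apply/eqP; rewrite eqn_leq n1.
subst n; have -> : m = 2%N by apply/eqP; rewrite eqn_leq le_m.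
case: c irr {MV NV sMN le_m} => [a|]; rewrite /rational /= ?eqxx // negb_or.
by move=> /andP[a0 a1]; apply: rt_step; apply: listed_V2_V1.
Qed.

End Classification.

Theorem proposition7p2p1 (k : closedFieldType) (char2 : 2%N \in [pchar k]) :
  (* (1) *)
  (Proj k = ideal_of (Dmod k) /\
   forall I : set (kV4mod k), tensor_ideal I ->
     (exists2 M, I M & nonzero M) -> Proj k `<=` I) /\
  (* (2) *)
  (ideal_of (trivial_mod k) = setT /\
   forall n : int,
     (exists M, heller n (trivial_mod k) M) /\
     (forall M, heller n (trivial_mod k) M ->
        ideal_of (trivial_mod k) = ideal_of M)) /\
  (* (3) *)
  (forall m n : nat, (0 < m < n)%N ->
     ideal_of (Vmod char2 m None) `<` ideal_of (Vmod char2 n None)) /\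
  (* (4) *)
  (forall (a : k) (m n : nat), (0 < m < n)%N ->
     ~ [/\ a != 0, a != 1, m = 1%N & n = 2%N] ->
     ideal_of (Vmod char2 m (Some a)) `<` ideal_of (Vmod char2 n (Some a))) /\
  (* (5) *)
  (forall a : k, a != 0 -> a != 1 ->
     ideal_of (Vmod char2 2 (Some a)) = ideal_of (Vmod char2 1 (Some a))) /\
  (* remaining assertions *)
  (forall (c : option k) (n : nat), (0 < n)%N ->
     Proj k `<` ideal_of (Vmod char2 n c) /\
     ideal_of (Vmod char2 n c) `<` ideal_of (trivial_mod k)) /\
  (forall M N : kV4mod k, indecomposable M -> indecomposable N ->
     ideal_of M `<=` ideal_of N ->
     clos_refl_trans (kV4mod k) (listed char2) M N).
Proof.
split; first by split; [exact: ProjE|exact: Proj_sub_ideal].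
split.
  split; first exact: ideal_of_trivial.
  move=> n; split; first exact: heller_exists.
  by move=> M HM; rewrite ideal_of_trivial (heller_ideal_of char2 HM).
split; first by move=> m n mn; apply: Vmod_lt => //; rewrite /rational eqxx.
split.
  move=> a m n mn not_exc; apply: Vmod_lt => //.
  apply/orP; have [rat|irr] := boolP (rational (Some a)); [by left|right].
  case/norP: irr => a0 a1; apply/negP => /eqP[em en].
  by apply: not_exc.
split; first exact: V2_eq_V1.
split; last exact: containment_listed.
by move=> c n n0; split; [exact: Proj_ltV|exact: V_lt_trivial].
Qed.
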